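(* Let $(A,\{\!\!\{-,-\}\!\!\})$ be a double Poisson algebra over the semisimple algebra $A_0=\oplus_{s\in I}\mathbb{C}e_s$. Assume that $\phi:A\to A$ is an involutive $\mathbb{C}$-linear anti-automorphism with $\phi(e_s)=e_s$ for all $s\in I$ and $(\phi\otimes\phi)(\{\!\!\{a,b\}\!\!\})=\{\!\!\{\phi(a),\phi(b)\}\!\!\}^\circ$ for all $a,b\in A$. For any dimension vector $\alpha\in\mathbb{N}^I$, $N=\sum_{s\in I}\alpha_s$, considering the involution $\tau$ on $\mathfrak{gl}_N$ given by transposition, the antisymmetric biderivation $\{-,-\}_{\phi,\mathrm{O}}$ on $\mathrm{Rep}^{\phi,\tau}(A,\alpha)$ uniquely determined by $$\{a_{ij},b_{kl}\}_{\phi,\mathrm{O}}=\tfrac12\{\!\!\{a,b\}\!\!\}_{kj,il}+\tfrac12\{\!\!\{\phi(a),b\}\!\!\}_{ki,jl},\qquad a,b\in A,\ 1\le i,j,k,l\le N,$$ is a Poisson bracket for which the action of $\mathrm{O}_\alpha:=\prod_{s\in I}\mathrm{O}(\alpha_s)$ is by Poisson automorphisms. Furthermore, if $\mu\in A$ is a moment map (for $\{\!\!\{-,-\}\!\!\}$) chosen to satisfy $\mu+\phi(\mu)=0$, then $\mathtt{X}(\mu):\mathrm{Rep}^{\phi,\tau}(A,\alpha)\to\mathfrak{o}_\alpha$ is a moment map for $\{-,-\}_{\phi,\mathrm{O}}$ after identifying $\mathfrak{o}_\alpha=\prod_{s\in I}\mathfrak{o}(\alpha_s)$ and its dual under the trace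 pairing.
   Context: Algebras are finitely generated, associative, unital over $\mathbb{C}$; $\otimes=\otimes_{\mathbb{C}}$. $I=\{1,\dots,|I|\}$ is finite, $A_0=\oplus_{s\in I}\mathbb{C}e_s$ with $e_se_t=\delta_{st}e_s$, $\sum_se_s=1$, and $A$ is an algebra over $A_0$ (contains the $e_s$ with these relations). Double brackets. Write $d=d'\otimes d''\in A\otimes A$; $(d'\otimes d'')^\circ=d''\otimes d'$; $a\,d\,b=ad'\otimes d''b$; $a\ast d\ast b=d'b\otimes ad''$. A double bracket is a $\mathbb{C}$-bilinear map $\{\!\!\{-,-\}\!\!\}:A\times A\to A\otimes A$ with $\{\!\!\{a,b\}\!\!\}=-\{\!\!\{b,a\}\!\!\}^\circ$, $\{\!\!\{a,bc\}\!\!\}=\{\!\!\{a,b\}\!\!\}c+b\{\!\!\{a,c\}\!\!\}$, $\{\!\!\{bc,a\}\!\!\}=\{\!\!\{b,a\}\!\!\}\ast c+b\ast\{\!\!\{c,a\}\!\!\}$, and $\{\!\!\{e,a\}\!\!\}=0=\{\!\!\{a,e\}\!\!\}$ for $e\in A_0$. With $\{\!\!\{a,d\}\!\!\}_L=\{\!\!\{a,d'\}\!\!\}\otimes d''$ and $\tau_{(123)}(a_1\otimes a_2\otimes a_3)=a_3\otimes a_1\otimes a_2$, its double Jacobiator is $\{\!\!\{a,b,c\}\!\!\}=\{\!\!\{a,\{\!\!\{b,c\}\!\!\}\}\!\!\}_L+\tau_{(123)}\{\!\!\{b,\{\!\!\{c,a\}\!\!\}\}\!\!\}_L+\tau_{(123)}^2\{\!\!\{c,\{\!\!\{a,b\}\!\!\}\}\!\!\}_L$;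 it is Poisson (and $(A,\{\!\!\{-,-\}\!\!\})$ is a double Poisson algebra) if this vanishes identically. A moment map is $\mu=\sum_s\mu_s$, $\mu_s\in e_sAe_s$, with $\{\!\!\{\mu_s,a\}\!\!\}=ae_s\otimes e_s-e_s\otimes e_sa$ for all $a\in A$, $s\in I$. Representation spaces. $\mathrm{Rep}(A,\alpha)$ is the affine scheme whose coordinate ring is generated by $a_{ij}$ ($a\in A$, $1\le i,j\le N$), linear in $a$, with $(ab)_{ij}=\sum_ra_{ir}b_{rj}$ and $(e_s)_{ij}=\delta_{ij}$ if $i,j\in\mathtt{R}_s:=\{\alpha_1+\dots+\alpha_{s-1}+1,\dots,\alpha_1+\dots+\alpha_s\}$, $(e_s)_{ij}=0$ otherwise. $\mathtt{X}(a)=(a_{ij})$ is the matrix-valued function representing $a$. Here $\mathbb{C}[\mathrm{Rep}^{\phi,\tau}(A,\alpha)]$ is the quotient of $\mathbb{C}[\mathrm{Rep}(A,\alpha)]$ by the ideal generated by all $\phi(a)_{ij}-a_{ji}$. Notation $(c\otimes d)_{kj,il}=c_{kj}d_{il}$. $\mathrm{O}_\alpha$, embedded block-diagonally in $\mathrm{GL}_N$, acts by $g\cdot\mathtt{X}(a)=g^{-1}\mathtt{X}(a)g$ on coordinate functions, with infinitesimal action of $\xi\in\mathfrak{o}_\alpha$ on functions given by $\xi_M(\mathtt{X}(a))=[\mathtt{X}(a),\xi]$. A moment map for a $G$-invariant Poisson bracket on $M$ is a $G$-equivariant morphism $\mu:M\to\mathfrak{g}^*$ with $\{\langle\mu,\xi\rangle,-\}=\xi_M$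 for all $\xi\in\mathfrak g$; under the trace pairing, $\langle\mathtt{X}(\mu),\xi\rangle=\mathrm{tr}(\mathtt{X}(\mu)\xi)$. *)

(* Defs.v *)
From HB Require Import structures.
From mathcomp Require Import all_boot all_order all_algebra.
From mathcomp Require Import finmap.
From mathcomp.multinomials Require Import monalg.
From mathcomp Require Import boolp reals complex.

Set Implicit Arguments.
Unset Strict Implicit.
Unset Printing Implicit Defensive.

Import GRing.Theory.

Local Open Scope ring_scope.
Local Open Scope quotient_scope.

Section QuotLift.
Variables (M : zmodType) (J : zmodClosed M).

Lemma eq_quotP (x y : M) :
  (\pi_(Quotient.quot J) x = \pi_(Quotient.quot J) y) <-> (x - y \in J).
Proof. by rewrite Quotient.idealrBE; split => /eqP. Qed.

Definition quot_lift (W : Type) (f : M -> W) (x : Quotient.quot J) : W :=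
  f (repr x).

Lemma quot_liftE (W : zmodType) (f : M -> W) : zmod_morphism f ->
  (forall x, x \in J -> f x = 0) ->
  forall x, quot_lift f (\pi_(Quotient.quot J) x) = f x.
Proof.
move=> fB fJ x; apply/eqP; rewrite -subr_eq0 -fB fJ //.
by apply/eq_quotP; rewrite reprK.
Qed.

End QuotLift.

Section ModuleQuotient.
Variables (K : pzRingType) (M : lmodType K) (G : M -> Prop).

Inductive span : M -> Prop :=
| span_gen x : G x -> span x
| span_zero : span 0
| span_lin c x y : span x -> span y -> span (c *: x + y).

Definition span_pred (x : M) : bool := `[< span x >].

Fact span_submod_closed : submod_closed span_pred.
Proof.
split; first exact/asboolP/span_zero.
by move=> c x y /asboolP sx /asboolP sy; apply/asboolP/span_lin.
Qed.

HB.instance Definition _ := GRing.isZmodClosed.Build M span_pred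
  (GRing.submod_closedB span_submod_closed).
Definition span_zmod : zmodClosed M := GRing.ZmodClosed.clone M span_pred _.

Definition modquot := Quotient.quot span_zmod.
HB.instance Definition _ := GRing.Zmodule.on modquot.

End ModuleQuotient.

(* The locks keep unification from unfolding quotients. *)
HB.lock Definition modpi (K : pzRingType) (M : lmodType K) (G : M -> Prop)
  (x : M) : modquot G := \pi_(Quotient.quot (span_zmod G)) x.

HB.lock Definition modquot_scale (K : pzRingType) (M : lmodType K)
  (G : M -> Prop) (c : K) (x : modquot G) : modquot G := modpi G (c *: repr x).

Section ModuleQuotientTheory.
Variables (K : pzRingType) (M : lmodType K) (G : M -> Prop).
Local Notation modquot := (modquot G).
Local Notation modpi := (modpi G).
Local Notation modquot_scale := (@modquot_scale K M G).

Fact modpi_zmod : zmod_morphism modpi.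
Proof. by move=> x y; rewrite modpi.unlock raddfB. Qed.
HB.instance Definition _ := GRing.isZmodMorphism.Build M modquot modpi modpi_zmod.

Lemma modpi_repr (x : modquot) : modpi (repr x) = x.
Proof. by rewrite modpi.unlock; apply: reprK. Qed.

Fact modpiZ c x : modpi (c *: x) = modquot_scale c (modpi x).
Proof.
rewrite modquot_scale.unlock modpi.unlock.
apply/eq_quotP; rewrite -scalerBr -[_ *: _]addr0.
apply: (span_submod_closed G).2; last exact: (span_submod_closed G).1.
by apply/eq_quotP; rewrite reprK.
Qed.

Fact modquot_scalerA a b x :
  modquot_scale a (modquot_scale b x) = modquot_scale (a * b) x.
Proof. by rewrite -[x]modpi_repr -!modpiZ scalerA. Qed.
Fact modquot_scale1r : left_id 1 modquot_scale.
Proof. by move=> x; rewrite -[x]modpi_repr -!modpiZ scale1r. Qed.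
Fact modquot_scalerDr : right_distributive modquot_scale +%R.
Proof.
move=> a x y; rewrite -[x]modpi_repr -[y]modpi_repr -raddfD -!modpiZ scalerDr.
exact: (raddfD (modpi : {additive _ -> _})).
Qed.
Fact modquot_scalerDl x : {morph modquot_scale^~ x : a b / a + b}.
Proof. 
move=> a b; rewrite -[x]modpi_repr -!modpiZ scalerDl.
exact: (raddfD (modpi : {additive _ -> _})).
 Qed.

HB.instance Definition _ := GRing.Zmodule_isLmodule.Build K modquot
  modquot_scalerA modquot_scale1r modquot_scalerDr modquot_scalerDl.

Fact modpi_scalable : scalable modpi.
Proof. by move=> c x; rewrite modpiZ. Qed.
HB.instance Definition _ := GRing.isScalable.Build K M modquot *:%R modpi
  modpi_scalable.

End ModuleQuotientTheory.

(* MathComp's {ideal_quot I} asks for a proper ideal.  Coordinate rings of    *)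
(* representations may be zero, so the ideal is arbitrary here and the        *)
(* quotient is only a comPzRingType.                                          *)
Section RingQuotient.
Variables (B : comPzRingType) (G : B -> Prop).

Inductive ideal : B -> Prop :=
| ideal_gen x : G x -> ideal x
| ideal_zero : ideal 0
| ideal_add x y : ideal x -> ideal y -> ideal (x + y)
| ideal_mul b x : ideal x -> ideal (b * x).

Definition ideal_pred (x : B) : bool := `[< ideal x >].

Fact ideal_zmod_closed : zmod_closed ideal_pred.
Proof.
split; first exact/asboolP/ideal_zero.
move=> x y /asboolP sx /asboolP sy; apply/asboolP/ideal_add => //.
by rewrite -mulN1r; apply: ideal_mul.
Qed.

HB.instance Definition _ := GRing.isZmodClosed.Build B ideal_pred
  ideal_zmod_closed.
Definition ideal_zmod : zmodClosed B := GRing.ZmodClosed.clone B ideal_pred _.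

Definition ringquot := Quotient.quot ideal_zmod.
HB.instance Definition _ := GRing.Zmodule.on ringquot.

End RingQuotient.

HB.lock Definition ringpi (B : comPzRingType) (G : B -> Prop) (x : B) :
  ringquot G := \pi_(Quotient.quot (ideal_zmod G)) x.

HB.lock Definition ringquot_mul (B : comPzRingType) (G : B -> Prop)
  (x y : ringquot G) : ringquot G := ringpi G (repr x * repr y).

Section RingQuotientTheory.
Variables (B : comPzRingType) (G : B -> Prop).
Local Notation ringquot := (ringquot G).
Local Notation ringpi := (ringpi G).
Local Notation ringquot_mul := (@ringquot_mul B G).
Local Notation ideal_pred := (ideal_pred G).
Local Notation ideal := (ideal G).

Fact ringpi_zmod : zmod_morphism ringpi.
Proof. by move=> x y; rewrite ringpi.unlock raddfB. Qed.
HB.instance Definition _ := GRing.isZmodMorphism.Build B ringquot ringpi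
  ringpi_zmod.

Lemma ringpi_repr (x : ringquot) : ringpi (repr x) = x.
Proof. by rewrite ringpi.unlock; apply: reprK. Qed.

Fact ringpiM x y : ringpi (x * y) = ringquot_mul (ringpi x) (ringpi y).
Proof.
rewrite ringquot_mul.unlock ringpi.unlock; apply/eq_quotP; set x' := repr _; set y' := repr _.
have IM b z : z \in ideal_pred -> b * z \in ideal_pred.
  by move=> /asboolP iz; apply/asboolP/ideal_mul.
have -> : x * y - x' * y' = y * (x - x') + x' * (y - y').
  by rewrite !mulrBr [y * x]mulrC [y * x']mulrC addrA subrK.
by rewrite rpredD // IM //; apply/eq_quotP; rewrite reprK.
Qed.

Fact ringquot_mulA : associative ringquot_mul.
Proof.
move=> x y z; rewrite -[x]ringpi_repr -[y]ringpi_repr -[z]ringpi_repr.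
by rewrite -!ringpiM mulrA.
Qed.
Fact ringquot_mulC : commutative ringquot_mul.
Proof.
by move=> x y; rewrite -[x]ringpi_repr -[y]ringpi_repr -!ringpiM mulrC.
Qed.
Fact ringquot_mul1 : left_id (ringpi 1) ringquot_mul.
Proof. by move=> x; rewrite -[x]ringpi_repr -ringpiM mul1r. Qed.
Fact ringquot_mulDl : left_distributive ringquot_mul +%R.
Proof.
move=> x y z; rewrite -[x]ringpi_repr -[y]ringpi_repr -[z]ringpi_repr.
by rewrite -raddfD -!ringpiM -raddfD mulrDl.
Qed.
HB.instance Definition _ := GRing.Zmodule_isComPzRing.Build ringquot
  ringquot_mulA ringquot_mulC ringquot_mul1 ringquot_mulDl.

Fact ringpi_monoid : monoid_morphism ringpi.
Proof. by split=> // x y; rewrite ringpiM. Qed.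
HB.instance Definition _ := GRing.isMonoidMorphism.Build B ringquot ringpi
  ringpi_monoid.

Lemma ringpi_eq0 x : ringpi x = 0 <-> ideal x.
Proof.
rewrite (esym (raddf0 ringpi) : 0 = ringpi 0) ringpi.unlock; split=> [/eq_quotP|ix].
  by rewrite subr0 => /asboolP.
by apply/eq_quotP; rewrite subr0; apply/asboolP.
Qed.

Lemma ringpi_gen x : G x -> ringpi x = 0.
Proof. by move=> Gx; apply/ringpi_eq0/ideal_gen. Qed.

Section Lift.
Variables (W : comPzRingType) (f : B -> W).
Hypotheses (fB : zmod_morphism f) (fM : monoid_morphism f).
Hypothesis fG : forall x, G x -> f x = 0.

Local Notation F := (quot_lift f : ringquot -> W).

Lemma ringquot_liftE x : F (ringpi x) = f x.
Proof.
rewrite ringpi.unlock; apply: quot_liftE => // {}x /asboolP.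
have f0 : f 0 = 0 by rewrite -(subrr 0) fB subrr.
have fN y : f (- y) = - f y by rewrite -[- y]add0r fB f0 add0r.
elim=> {x} [x /fG|//|x y _ fx _ fy|b x _ fx] //; last by rewrite fM.2 fx mulr0.
by rewrite -[y]opprK fB fN fx fy !oppr0 addr0.
Qed.

Lemma ringquot_lift_zmod : zmod_morphism F.
Proof.
move=> x y; rewrite -[x]ringpi_repr -[y]ringpi_repr -raddfB.
by rewrite !ringquot_liftE fB.
Qed.

Lemma ringquot_lift_monoid : monoid_morphism F.
Proof.
split=> [|x y]; first by rewrite -[1 in LHS]/(ringpi 1) ringquot_liftE fM.1.
rewrite -[x]ringpi_repr -[y]ringpi_repr -rmorphM.
by rewrite !ringquot_liftE fM.2.
Qed.

End Lift.

End RingQuotientTheory.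


(* Locked, because comparing distinct << t >> by conversion can diverge. *)
HB.lock Definition mbasis (K : nzRingType) (T : choiceType) (t : T) :
  {malg K[T]} := << t >>.

Section TensorProduct.
Variables (K : nzRingType) (U V : lmodType K).

Local Notation free u v := (mbasis K (u, v)).

Inductive tensor_rel : {malg K[(U * V)%type]} -> Prop :=
| tensor_linl c u u' v :
    tensor_rel (free (c *: u + u') v - (c *: free u v + free u' v))
| tensor_linr c u v v' :
    tensor_rel (free u (c *: v + v') - (c *: free u v + free u v')).

Definition tensor := modquot tensor_rel.
HB.instance Definition _ := GRing.Lmodule.on tensor.

Definition tpure (u : U) (v : V) : tensor := modpi tensor_rel (free u v).

Definition free_lift (W : lmodType K) (f : U -> V -> W)
    (p : {malg K[(U * V)%type]}) : W :=
  \sum_(k <- msupp p) p@_k *: f k.1 k.2.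

(* The linear map with u ⊗ v |-> f u v; it is only meaningful for bilinear f, *)
(* see tlift_pure and tlift_linear.                                           *)
Definition tlift (W : lmodType K) (f : U -> V -> W) : tensor -> W :=
  quot_lift (free_lift f).

End TensorProduct.

Notation "u '⊗' v" := (tpure u v) (at level 40, left associativity) : ring_scope.

Section TensorLift.
Variables (K : nzRingType) (U V W : lmodType K) (f : U -> V -> W).

Fact free_liftEw (d : {fset (U * V)%type}) (p : {malg K[(U * V)%type]}) :
  (msupp p `<=` d)%fset -> free_lift f p = \sum_(k <- d) p@_k *: f k.1 k.2.
Proof.
move=> le; rewrite /free_lift (big_fset_incl _ le) //= => x _ /mcoeff_outdom ->.
by rewrite scale0r.
Qed.

Fact free_lift_linear : linear (free_lift f).
Proof.
move=> c p q; pose d := (msupp p `|` msupp q `|` msupp (c *: p + q))%fset.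
have sp : (msupp p `<=` d)%fset by rewrite /d -fsetUA fsubsetUl.
have sq : (msupp q `<=` d)%fset by rewrite /d fsetUAC fsubsetUr.
have sr : (msupp (c *: p + q) `<=` d)%fset by rewrite /d fsubsetUr.
rewrite !(free_liftEw (d := d)) // scaler_sumr -big_split /=.
by apply: eq_bigr => k _; rewrite mcoeffD mcoeffZ scalerDl scalerA.
Qed.

Fact free_lift_zmod : zmod_morphism (free_lift f).
Proof.
move=> x y; have -> : x - y = (-1) *: y + x by rewrite scaleN1r addrC.
by rewrite free_lift_linear scaleN1r addrC.
Qed.

Fact free_liftU u v : free_lift f (mbasis K (u, v)) = f u v.
Proof.
rewrite mbasis.unlock (free_liftEw (d := [fset (u, v)]%fset)) ?msuppU_le //.
by rewrite big_seq_fset1 mcoeffUU scale1r.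
Qed.

Definition bilinear_map : Prop :=
  (forall v, linear (f^~ v)) /\ (forall u, linear (f u)).

Hypothesis fB : bilinear_map.

Fact free_lift_rel p : p \in span_pred (@tensor_rel K U V) -> free_lift f p = 0.
Proof.
have L := free_lift_linear.
have LB := free_lift_zmod.
have L0 : free_lift f 0 = 0 by rewrite -(subrr 0) LB subrr.
move=> /asboolP; elim=> {p} [p [] c u u' v|//|c x y _ fx _ fy].
- by rewrite LB L !free_liftU fB.1 subrr.
- by rewrite LB L !free_liftU fB.2 subrr.
- by rewrite L fx fy scaler0 addr0.
Qed.

Fact tliftE p : tlift f (modpi (@tensor_rel K U V) p) = free_lift f p.
Proof.
rewrite modpi.unlock.
by apply: quot_liftE; [exact: free_lift_zmod | exact: free_lift_rel].
Qed.

Lemma tlift_pure u v : tlift f (u ⊗ v) = f u v.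
Proof. by rewrite /tpure tliftE free_liftU. Qed.

Lemma tlift_linear : linear (tlift f).
Proof.
move=> c x y; rewrite -[x]modpi_repr -[y]modpi_repr -linearP !tliftE.
exact: free_lift_linear.
Qed.

End TensorLift.

(* Evaluation of polynomials in the variables I at the point h of a           *)
(* commutative K-algebra B with structure map iota (mmap in monalg asks for a *)
(* nonzero target).                                                           *)
Section PolyEval.
Variables (K : comNzRingType) (I : choiceType) (B : comPzRingType).
Variables (iota : {rmorphism K -> B}) (h : I -> B).

Definition mon_eval (m : {cmonom I}) : B := \prod_(v <- finsupp m) h v ^+ m v.

Definition poly_eval (p : {malg K[{cmonom I}]}) : B :=
  \sum_(m <- msupp p) iota p@_m * mon_eval m.

Fact mon_evalEw (d : {fset I}) (m : {cmonom I}) : (finsupp m `<=` d)%fset ->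
  mon_eval m = \prod_(v <- d) h v ^+ m v.
Proof.
move=> le; rewrite /mon_eval (big_fset_incl _ le) //= => v _.
by move=> /fsfun_dflt ->; rewrite expr0.
Qed.

Fact mon_evalM (m1 m2 : {cmonom I}) :
  mon_eval (mmul m1 m2) = mon_eval m1 * mon_eval m2.
Proof.
set d := (finsupp m1 `|` finsupp m2)%fset.
rewrite !(mon_evalEw (d := d)) ?mdomD ?fsubsetUl ?fsubsetUr //.
by rewrite -big_split /=; apply: eq_bigr => v _; rewrite cmM exprD.
Qed.

Fact mon_eval1 : mon_eval mone = 1.
Proof. by rewrite /mon_eval mdom1 big_seq_fset0. Qed.

Fact mon_evalU v : mon_eval (ucm v) = h v.
Proof. by rewrite /mon_eval mdomU big_seq_fset1 cmUU expr1. Qed.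

Fact poly_evalEw (d : {fset {cmonom I}}) (p : {malg K[{cmonom I}]}) :
  (msupp p `<=` d)%fset -> poly_eval p = \sum_(m <- d) iota p@_m * mon_eval m.
Proof.
move=> le; rewrite /poly_eval (big_fset_incl _ le) //= => m _ /mcoeff_outdom ->.
by rewrite raddf0 mul0r.
Qed.

Fact poly_eval_zmod : zmod_morphism poly_eval.
Proof.
move=> p q; pose d := (msupp p `|` msupp q `|` msupp (p - q))%fset.
have sp : (msupp p `<=` d)%fset by rewrite /d -fsetUA fsubsetUl.
have sq : (msupp q `<=` d)%fset by rewrite /d fsetUAC fsubsetUr.
have sr : (msupp (p - q) `<=` d)%fset by rewrite /d fsubsetUr.
rewrite !(poly_evalEw (d := d)) // -sumrB.
by apply: eq_bigr => m _; rewrite mcoeffB rmorphB mulrBl.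
Qed.
HB.instance Definition _ := GRing.isZmodMorphism.Build _ B poly_eval
  poly_eval_zmod.

Lemma poly_evalU c m : poly_eval << c *g m >> = iota c * mon_eval m.
Proof.
rewrite (poly_evalEw (d := [fset m]%fset)) ?msuppU_le //.
by rewrite big_seq_fset1 mcoeffUU.
Qed.

Fact poly_eval_monoid : monoid_morphism poly_eval.
Proof.
split=> [|p q]; first by rewrite poly_evalU rmorph1 mul1r mon_eval1.
rewrite malgME raddf_sum {2}/poly_eval mulr_suml; apply: eq_bigr => m1 _.
rewrite raddf_sum /poly_eval mulr_sumr; apply: eq_bigr => m2 _.
by rewrite -[LHS]/(poly_eval _) poly_evalU rmorphM mon_evalM mulrACA.
Qed.
HB.instance Definition _ := GRing.isMonoidMorphism.Build _ B poly_eval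
  poly_eval_monoid.

Lemma poly_eval_var v : poly_eval (mbasis K (ucm v)) = h v.
Proof. by rewrite mbasis.unlock poly_evalU rmorph1 mul1r mon_evalU. Qed.

Lemma poly_evalC c : poly_eval c%:MP = iota c.
Proof. by rewrite poly_evalU mon_eval1 mulr1. Qed.

End PolyEval.

Fact conj_mulmx (B : pzSemiRingType) p (U V M M' : 'M[B]_p) : U *m V = 1%:M ->
  V *m (M *m M') *m U = (V *m M *m U) *m (V *m M' *m U).
Proof. by move=> UV; rewrite !mulmxA -[_ *m U *m V]mulmxA UV mulmx1. Qed.

Fact zmod_morphD (U V : zmodType) (F : U -> V) :
  zmod_morphism F -> {morph F : x y / x + y}.
Proof.
move=> FB x y; have F0 : F 0 = 0 by rewrite -(subrr 0) FB subrr.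
by rewrite -{1}[y]opprK FB -[- y]sub0r FB F0 sub0r opprK.
Qed.

Fact trmx_conj (B : comPzRingType) p (U V M : 'M[B]_p) : V = U^T ->
  V *m M^T *m U = (V *m M *m U)^T.
Proof. by move=> ->; rewrite !trmx_mul trmxK mulmxA. Qed.

(* O_alpha and its Lie algebra, as families of blocks; \mxdiag is the         *)
(* block-diagonal embedding in N x N matrices.                                *)
Section OrthogonalGroup.
Variables (K : comNzRingType) (n : nat) (alpha : 'I_n -> nat).

Definition orthogonal_blocks (g : forall s, 'M[K]_(alpha s)) : Prop :=
  forall s, (g s)^T *m g s = 1%:M.

Definition skew_blocks (xi : forall s, 'M[K]_(alpha s)) : Prop :=
  forall s, (xi s)^T = - xi s.

(* tagnat.sig1 i is the s such that i belongs to the block R_s of indices. *)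
Lemma sig1_interval (i : 'I_(\sum_s alpha s)) (s : 'I_n) :
  (tagnat.sig1 i == s) =
  (\sum_(t < n | (t < s)%N) alpha t <= i < \sum_(t < n | (t <= s)%N) alpha t)%N.
Proof.
rewrite -[in RHS](tagnat.sig2K i) tagnat.RankEsum.
have lt2 := ltn_ord (tagnat.sig2 i).
move: (tagnat.sig1 i) (tagnat.sig2 i : nat) lt2 => t j lt2.
have sumS (u : 'I_n) : (\sum_(k < n | (k <= u)%N) alpha k =
    \sum_(k < n | (k < u)%N) alpha k + alpha u)%N.
  rewrite (bigD1 u) //= addnC; congr (_ + _)%N; apply: eq_bigl => k.
  by rewrite ltn_neqAle andbC.
have le_sum (u v : 'I_n) : (u < v)%N ->
    (\sum_(k < n | (k <= u)%N) alpha k <= \sum_(k < n | (k < v)%N) alpha k)%N.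
  move=> uv; rewrite [leqRHS]big_mkcond [leqLHS]big_mkcond /=.
  apply: leq_sum => k _; case: (leqP k u) => // ku; by rewrite (leq_ltn_trans ku uv).
have [<-|nts] := eqVneq t s; first by rewrite sumS leq_addr ltn_add2l lt2.
apply/esym/negbTE; rewrite negb_and -ltnNge -leqNgt.
have [ts|st|/val_inj ets] := ltngtP t s; last by rewrite ets eqxx in nts.
  apply/orP; left; apply: leq_trans (le_sum _ _ ts).
  by rewrite sumS ltn_add2l.
by apply/orP; right; apply: leq_trans (le_sum _ _ st) (leq_addr _ _).
Qed.

Lemma mxdiag_off (D : forall s, 'M[K]_(alpha s)) i j :
  tagnat.sig1 i != tagnat.sig1 j -> (\mxdiag_s D s) i j = 0.
Proof. by move=> ij; rewrite !mxE (negbTE ij) mxE. Qed.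

Lemma mul_mxdiag (D E : forall s, 'M[K]_(alpha s)) :
  \mxdiag_s D s *m \mxdiag_s E s = \mxdiag_s (D s *m E s).
Proof.
rewrite [X in _ *m X]/mxdiag mul_mxdiag_mxblock; apply/eq_mxblockP => s t.
by case: eqVneq => [->|_]; rewrite ?conform_mx_id ?mulmx0.
Qed.

Fact mul_idem_mxdiag (B : comPzRingType) (iota : {rmorphism K -> B})
    (D : forall s, 'M[K]_(alpha s)) s :
  let E := \matrix_(i, j) ((i == j) && (tagnat.sig1 i == s))%:R in
  E *m map_mx iota (\mxdiag_t D t) = map_mx iota (\mxdiag_t D t) *m E.
Proof.
move=> E; have -> : E = diag_mx (\row_i (tagnat.sig1 i == s)%:R).
  by apply/matrixP => i j; rewrite !mxE; case: eqVneq; rewrite ?mulr0n ?mulr1n.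
rewrite mul_diag_mx mul_mx_diag; apply/matrixP => i j.
rewrite mxE [RHS]mxE [(map_mx _ _) i j]mxE [in LHS]mxE [X in _ = _ * X]mxE.
rewrite mulrC; have [->//|nij] := eqVneq (tagnat.sig1 i) (tagnat.sig1 j).
by rewrite mxdiag_off // rmorph0 !mul0r.
Qed.

End OrthogonalGroup.

Section RepresentationSpace.
Variables (K : fieldType) (A : algType K) (n : nat) (e : 'I_n -> A).
Variable (alpha : 'I_n -> nat).
Local Notation N := (\sum_s alpha s)%N.

Definition rep_poly := {malg K[{cmonom (A * 'I_N * 'I_N)%type}]}.
HB.instance Definition _ := GRing.ComAlgebra.on rep_poly.

Definition rep_var (a : A) (i j : 'I_N) : rep_poly :=
  mbasis K (ucm (a, i, j)).

Inductive rep_rel : rep_poly -> Prop :=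
| rep_rel_lin c a b i j :
    rep_rel (rep_var (c *: a + b) i j - (c *: rep_var a i j + rep_var b i j))
| rep_rel_mul a b i j :
    rep_rel (rep_var (a * b) i j - \sum_r rep_var a i r * rep_var b r j)
| rep_rel_idem s i j :
    rep_rel (rep_var (e s) i j - ((i == j) && (tagnat.sig1 i == s))%:R).

(* C[Rep(A, alpha)] *)
Definition rep_ring := ringquot rep_rel.
HB.instance Definition _ := GRing.ComPzRing.on rep_ring.

Definition rep_gen (a : A) (i j : 'I_N) : rep_ring := ringpi rep_rel (rep_var a i j).

Section Involution.
Variable (phi : A -> A).

Inductive irep_rel : rep_ring -> Prop :=
| irep_rel_tr a i j : irep_rel (rep_gen (phi a) i j - rep_gen a j i).

(* C[Rep^{phi,tau}(A, alpha)], tau being transposition *)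
Definition irep_ring := ringquot irep_rel.
HB.instance Definition _ := GRing.ComPzRing.on irep_ring.

Definition irep_pi : rep_poly -> irep_ring := ringpi irep_rel \o ringpi rep_rel.
HB.instance Definition _ := GRing.RMorphism.on irep_pi.

Definition irep_const : K -> irep_ring := irep_pi \o malgC.
HB.instance Definition _ := GRing.RMorphism.on irep_const.

Definition irep_scale (c : K) (f : irep_ring) : irep_ring := irep_const c * f.
Fact irep_scalerA a b f : irep_scale a (irep_scale b f) = irep_scale (a * b) f.
Proof. by rewrite /irep_scale rmorphM mulrA. Qed.
Fact irep_scale1r : left_id 1 irep_scale.
Proof. by move=> f; rewrite /irep_scale rmorph1 mul1r. Qed.
Fact irep_scalerDr : right_distributive irep_scale +%R.
Proof. by move=> c f g; rewrite /irep_scale mulrDr. Qed.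
Fact irep_scalerDl f : {morph irep_scale^~ f : a b / a + b}.
Proof. by move=> a b; rewrite /irep_scale rmorphD mulrDl. Qed.
HB.instance Definition _ := GRing.Zmodule_isLmodule.Build K irep_ring
  irep_scalerA irep_scale1r irep_scalerDr irep_scalerDl.

(* The matrix X(a) = (a_ij) *)
Definition irep_X (a : A) : 'M[irep_ring]_N :=
  \matrix_(i, j) ringpi irep_rel (rep_gen a i j).

Lemma irep_scalerAl c (f g : irep_ring) : c *: (f * g) = (c *: f) * g.
Proof. exact: mulrA. Qed.

Fact irep_pi_var a i j : irep_pi (rep_var a i j) = irep_X a i j.
Proof. by rewrite mxE. Qed.

Fact irep_pi_surj (f : irep_ring) : exists p, irep_pi p = f.
Proof. by exists (repr (repr f)); rewrite /irep_pi /= !ringpi_repr. Qed.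

Fact irep_pi_eq p q : rep_rel (p - q) -> irep_pi p = irep_pi q.
Proof.
move=> /ringpi_gen rpq; apply/eqP; rewrite -subr_eq0 -(rmorphB irep_pi).
apply/eqP; rewrite -[LHS]/(ringpi irep_rel (ringpi rep_rel (p - q))).
by rewrite rpq rmorph0.
Qed.

Fact irep_piZ c p : irep_pi (c *: p) = c *: irep_pi p.
Proof.
have -> : c *: p = c%:MP * p by rewrite mul_malgC.
by rewrite (rmorphM irep_pi).
Qed.

Lemma irep_X_linear c a b i j :
  irep_X (c *: a + b) i j = c *: irep_X a i j + irep_X b i j.
Proof.
rewrite !mxE; apply: etrans (irep_pi_eq (rep_rel_lin c a b i j)) _.
by apply: etrans (rmorphD irep_pi _ _) _; congr (_ + _); apply: irep_piZ.
Qed.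

Lemma irep_X_mul a b : irep_X (a * b) = irep_X a *m irep_X b.
Proof.
apply/matrixP => i j; rewrite !mxE.
apply: etrans (irep_pi_eq (rep_rel_mul a b i j)) _.
rewrite (rmorph_sum irep_pi); apply: eq_bigr => r _.
by rewrite !mxE; apply: (rmorphM irep_pi).
Qed.

Lemma irep_X_idem s :
  irep_X (e s) = \matrix_(i, j) ((i == j) && (tagnat.sig1 i == s))%:R.
Proof.
apply/matrixP => i j; rewrite !mxE.
apply: etrans (irep_pi_eq (rep_rel_idem s i j)) _.
exact: (rmorph_nat irep_pi).
Qed.

Lemma irep_X_phi a : irep_X (phi a) = (irep_X a)^T.
Proof.
apply/matrixP => i j; rewrite !mxE; apply/eqP; rewrite -subr_eq0 -rmorphB.
by apply/eqP/ringpi_gen.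
Qed.

(* The algebra morphism out of C[Rep^{phi,tau}] with X(a) |-> x a, for x      *)
(* satisfying the defining relations.                                         *)
Section Lift.
Variables (B : comPzRingType) (iota : {rmorphism K -> B}) (x : A -> 'M[B]_N).

Definition rep_eval : rep_poly -> B :=
  poly_eval iota (fun v : A * 'I_N * 'I_N => x v.1.1 v.1.2 v.2).
HB.instance Definition _ := GRing.RMorphism.on rep_eval.

Definition irep_lift : irep_ring -> B := quot_lift (quot_lift rep_eval).

Hypotheses
  (x_lin : forall c a b, x (c *: a + b) = iota c *: x a + x b)
  (x_mul : forall a b, x (a * b) = x a *m x b)
  (x_idem : forall s,
     x (e s) = \matrix_(i, j) ((i == j) && (tagnat.sig1 i == s))%:R)
  (x_phi : forall a, x (phi a) = (x a)^T).

Fact rep_eval_var a i j : rep_eval (rep_var a i j) = x a i j.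
Proof. exact: poly_eval_var. Qed.

Fact rep_eval_rel p : rep_rel p -> rep_eval p = 0.
Proof.
case=> [c a b i j|a b i j|s i j].
- apply: etrans (rmorphB rep_eval _ _) _; apply/eqP; rewrite subr_eq0 /=.
  apply/eqP; rewrite rep_eval_var x_lin 2!mxE.
  apply/esym; apply: etrans (rmorphD rep_eval _ _) _; congr (_ + _); last first.
    exact: rep_eval_var.
  apply: etrans (congr1 rep_eval (esym (mul_malgC _ _))) _.
  apply: etrans (rmorphM rep_eval _ _) _; congr (_ * _).
    exact: poly_evalC.
  exact: rep_eval_var.
- apply: etrans (rmorphB rep_eval _ _) _; apply/eqP; rewrite subr_eq0 /=.
  apply/eqP; rewrite rep_eval_var x_mul mxE; apply/esym.
  rewrite (rmorph_sum rep_eval); apply: eq_bigr => r _.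
  by rewrite (rmorphM rep_eval) /= !rep_eval_var.
- apply: etrans (rmorphB rep_eval _ _) _; apply/eqP; rewrite subr_eq0 /=.
  by apply/eqP; rewrite rep_eval_var x_idem mxE (rmorph_nat rep_eval).
Qed.

Let f1 : rep_ring -> B := quot_lift rep_eval.
Let f1E p : f1 (ringpi rep_rel p) = rep_eval p.
Proof. exact: ringquot_liftE (raddfB rep_eval) (rmorphism_monoidP rep_eval) rep_eval_rel p. Qed.
Let f1_zmod : zmod_morphism f1.
Proof. exact: ringquot_lift_zmod (raddfB rep_eval) (rmorphism_monoidP rep_eval) rep_eval_rel. Qed.
Let f1_monoid : monoid_morphism f1.
Proof. exact: ringquot_lift_monoid (raddfB rep_eval) (rmorphism_monoidP rep_eval) rep_eval_rel. Qed.
Let f1_rel p : irep_rel p -> f1 p = 0.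
Proof.
case=> a i j; rewrite f1_zmod !f1E.
by apply/eqP; rewrite subr_eq0 !rep_eval_var x_phi mxE.
Qed.

Lemma irep_lift_pi p : irep_lift (irep_pi p) = rep_eval p.
Proof.
by rewrite -f1E; apply: (ringquot_liftE f1_zmod f1_monoid f1_rel).
Qed.

Lemma irep_lift_zmod : zmod_morphism irep_lift.
Proof. exact: ringquot_lift_zmod f1_zmod f1_monoid f1_rel. Qed.

Lemma irep_lift_monoid : monoid_morphism irep_lift.
Proof. exact: ringquot_lift_monoid f1_zmod f1_monoid f1_rel. Qed.

Lemma irep_lift_X a i j : irep_lift (irep_X a i j) = x a i j.
Proof. by rewrite -irep_pi_var irep_lift_pi rep_eval_var. Qed.

Lemma irep_lift_const c : irep_lift (irep_const c) = iota c.
Proof. by rewrite irep_lift_pi; apply: poly_evalC. Qed.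

Lemma irep_liftZ c f : irep_lift (c *: f) = iota c * irep_lift f.
Proof. by rewrite irep_lift_monoid.2 irep_lift_const. Qed.

End Lift.

Definition irep_mx m1 m2 (M : 'M[K]_(m1, m2)) : 'M[irep_ring]_(m1, m2) :=
  map_mx irep_const M.

(* g.X(a) = g^-1 X(a) g, see irep_act_X; the lift is meaningful for g in O_alpha. *)
Definition irep_act (g : forall s, 'M[K]_(alpha s)) : irep_ring -> irep_ring :=
  let G := \mxdiag_s g s in
  irep_lift irep_const (fun a => irep_mx (invmx G) *m irep_X a *m irep_mx G).

Section Action.
Variable g : forall s, 'M[K]_(alpha s).
Hypothesis gO : orthogonal_blocks g.
Let G := \mxdiag_s g s.

Let GtG : G^T *m G = 1%:M.
Proof. by rewrite tr_mxdiag mul_mxdiag -mxdiagZ; apply: eq_mxdiag. Qed.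

Let Gunit : G \in unitmx. Proof. by case: (mulmx1_unit GtG). Qed.

Let invG : invmx G = G^T.
Proof. by rewrite -[RHS]mulmx1 -(mulmxV Gunit) mulmxA GtG mul1mx. Qed.

Let VG : irep_mx (invmx G) *m irep_mx G = 1%:M.
Proof. by rewrite -map_mxM mulVmx // map_mx1. Qed.

Let GV : irep_mx G *m irep_mx (invmx G) = 1%:M.
Proof. by rewrite -map_mxM mulmxV // map_mx1. Qed.

Let x (a : A) := irep_mx (invmx G) *m irep_X a *m irep_mx G.

Let x_lin c a b : x (c *: a + b) = irep_const c *: x a + x b.
Proof.
rewrite /x; have -> : irep_X (c *: a + b) = irep_const c *: irep_X a + irep_X b.
  by apply/matrixP => i j; rewrite irep_X_linear [RHS]mxE [X in _ = X + _]mxE.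
by rewrite mulmxDr mulmxDl -scalemxAr -scalemxAl.
Qed.

Let x_mul a b : x (a * b) = x a *m x b.
Proof.
by rewrite /x irep_X_mul; apply: conj_mulmx GV.
Qed.

Let x_idem s : x (e s) = \matrix_(i, j) ((i == j) && (tagnat.sig1 i == s))%:R.
Proof.
rewrite /x irep_X_idem -mulmxA mul_idem_mxdiag mulmxA.
by rewrite VG mul1mx.
Qed.

Let x_phi a : x (phi a) = (x a)^T.
Proof.
rewrite /x irep_X_phi; apply: trmx_conj.
by rewrite invG /irep_mx map_trmx.
Qed.

Lemma irep_act_X a i j :
  irep_act g (irep_X a i j) =
  (irep_mx (invmx G) *m irep_X a *m irep_mx G) i j.
Proof. exact: (irep_lift_X x_lin x_mul x_idem x_phi). Qed.

Lemma irep_act_linear : linear (irep_act g).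
Proof.
move=> c f h; apply: etrans (zmod_morphD _ _ _) _.
  exact: (irep_lift_zmod x_lin x_mul x_idem x_phi).
by congr (_ + _); apply: (irep_liftZ x_lin x_mul x_idem x_phi).
Qed.

Lemma irep_act_monoid : monoid_morphism (irep_act g).
Proof. exact: (irep_lift_monoid x_lin x_mul x_idem x_phi). Qed.

End Action.

Record antisym_biderivation (P : irep_ring -> irep_ring -> irep_ring) : Prop := {
  abd_linear : forall f, linear (P f);
  abd_antisym : forall f h, P f h = - P h f;
  abd_leibniz : forall f h k, P f (h * k) = P f h * k + h * P f k
}.

Definition poisson_bracket (P : irep_ring -> irep_ring -> irep_ring) : Prop :=
  antisym_biderivation P /\
  forall f h k, P f (P h k) + P h (P k f) + P k (P f h) = 0.

Record poisson_automorphism (P : irep_ring -> irep_ring -> irep_ring)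
    (F : irep_ring -> irep_ring) : Prop := {
  pa_linear : linear F;
  pa_monoid : monoid_morphism F;
  pa_bijective : bijective F;
  pa_bracket : forall f h, F (P f h) = P (F f) (F h)
}.

(* D is the vector field xi_M, i.e. the derivation with                       *)
(* xi_M(X(a)) = [X(a), xi].                                                   *)
Record infinitesimal_action (xi : forall s, 'M[K]_(alpha s))
    (D : irep_ring -> irep_ring) : Prop := {
  ia_linear : linear D;
  ia_leibniz : forall f h, D (f * h) = D f * h + f * D h;
  ia_X : forall a, map_mx D (irep_X a) =
    irep_X a *m irep_mx (\mxdiag_s xi s) - irep_mx (\mxdiag_s xi s) *m irep_X a
}.

Definition trace_pairing (m : 'M[irep_ring]_N) (xi : forall s, 'M[K]_(alpha s)) :
  irep_ring := \tr (m *m irep_mx (\mxdiag_s xi s)).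

(* A morphism from Rep^{phi,tau}(A, alpha) to o_alpha is an element m of      *)
(* o_alpha ⊗ C[Rep^{phi,tau}(A, alpha)].  As (g.f)(p) = f(g^-1.p), m is        *)
(* equivariant when g.<m, xi> = <m, Ad_g xi>.                                 *)
Record moment_map (P : irep_ring -> irep_ring -> irep_ring)
    (m : 'M[irep_ring]_N) : Prop := {
  mm_skew : m^T = - m;
  mm_block : forall i j, tagnat.sig1 i != tagnat.sig1 j -> m i j = 0;
  mm_equivariant : forall g xi, orthogonal_blocks g -> skew_blocks xi ->
    irep_act g (trace_pairing m xi) =
    trace_pairing m (fun s => g s *m xi s *m invmx (g s));
  mm_hamiltonian : forall xi, skew_blocks xi ->
    infinitesimal_action xi (P (trace_pairing m xi))
}.

(* (c ⊗ d)_{kj,il} = c_{kj} d_{il} *)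
Definition tensor_coord (k j i l : 'I_N) : tensor A A -> irep_ring :=
  tlift (fun c d => irep_X c k j * irep_X d i l).

Definition bracket_formula (dbr : A -> A -> tensor A A)
    (P : irep_ring -> irep_ring -> irep_ring) : Prop :=
  forall a b i j k l, P (irep_X a i j) (irep_X b k l) =
    2^-1 *: tensor_coord k j i l (dbr a b) +
    2^-1 *: tensor_coord k i j l (dbr (phi a) b).

End Involution.
End RepresentationSpace.

Section DoubleBracket.
Variables (K : nzRingType) (A : algType K).

Definition finitely_generated : Prop :=
  exists gens : seq A, forall S : A -> Prop,
    (forall x, x \in gens -> S x) -> S 1 ->
    (forall c x y, S x -> S y -> S (c *: x + y)) ->
    (forall x y, S x -> S y -> S (x * y)) ->
    forall x, S x.

Definition idempotent_system (n : nat) (e : 'I_n -> A) : Prop :=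
  (forall s t, e s * e t = if s == t then e s else 0) /\ \sum_s e s = 1.

Definition tswap : tensor A A -> tensor A A := tlift (fun x y => y ⊗ x).

Definition tensor_map (phi : A -> A) : tensor A A -> tensor A A :=
  tlift (fun x y => phi x ⊗ phi y).

Definition touter (a : A) (d : tensor A A) (b : A) : tensor A A :=
  tlift (fun x y => (a * x) ⊗ (y * b)) d.

Definition tinner (a : A) (d : tensor A A) (b : A) : tensor A A :=
  tlift (fun x y => (x * b) ⊗ (a * y)) d.

Definition tau123 : tensor (tensor A A) A -> tensor (tensor A A) A :=
  tlift (fun d z => tlift (fun x y => (z ⊗ x) ⊗ y) d).

Variables (n : nat) (e : 'I_n -> A) (dbr : A -> A -> tensor A A).

Record double_bracket : Prop := {
  db_linearl : forall b, linear (dbr^~ b);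
  db_linearr : forall a, linear (dbr a);
  db_antisym : forall a b, dbr a b = - tswap (dbr b a);
  db_leibnizr : forall a b c,
    dbr a (b * c) = touter 1 (dbr a b) c + touter b (dbr a c) 1;
  db_leibnizl : forall a b c,
    dbr (b * c) a = tinner 1 (dbr b a) c + tinner b (dbr c a) 1;
  db_A0l : forall (c : 'I_n -> K) a, dbr (\sum_s c s *: e s) a = 0;
  db_A0r : forall (c : 'I_n -> K) a, dbr a (\sum_s c s *: e s) = 0
}.

Definition dbrL (a : A) : tensor A A -> tensor (tensor A A) A :=
  tlift (fun x y => dbr a x ⊗ y).

Definition double_jacobiator (a b c : A) : tensor (tensor A A) A :=
  dbrL a (dbr b c) + tau123 (dbrL b (dbr c a)) +
  tau123 (tau123 (dbrL c (dbr a b))).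

Definition double_poisson : Prop :=
  double_bracket /\ forall a b c, double_jacobiator a b c = 0.

Definition double_moment_map (mu : A) : Prop :=
  exists mu_ : 'I_n -> A,
    [/\ mu = \sum_s mu_ s,
        forall s, exists x, mu_ s = e s * x * e s &
        forall s a, dbr (mu_ s) a = (a * e s) ⊗ e s - e s ⊗ (e s * a)].

End DoubleBracket.

(* Main.v *)
Require Import Defs.
From HB Require Import structures.
From mathcomp Require Import all_boot all_order all_algebra.
From mathcomp Require Import finmap.
From mathcomp.multinomials Require Import monalg.
From mathcomp Require Import boolp reals complex.

(* A double bracket {{-,-}} defines on generators the form                    *)
(*   F0(a_ij; b_kl) = {{a, b}}_{kj,il},                                       *)
(* and compatibility with phi says that F0 is invariant under flipping both   *)
(* arguments, where flip (a_ij) = phi(a)_ji.  Averaging F0 over flips of one  *)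
(* argument therefore gives a form that descends to the coordinate ring; it   *)
(* is extended to a biderivation by lifting twice to dual numbers.            *)
(* For the Jacobi identity, the component G(x; y; z) of {{a, {{b, c}}}}_L     *)
(* satisfies G(x; y; z) + G(y; z; x) + G(z; x; y) = 0 by the double Jacobi    *)
(* identity, and flipping all three generators gives - G(x; z; y).  With the  *)
(* latter, {x, {y, z}} becomes 1/4 of the sum of G over all eight flips of    *)
(* (x, y, z), so the cyclic sum vanishes term by term.                        *)
(* The action of O_alpha and the moment map are handled in the coordinate-    *)
(* free form {tr X(a)M, tr X(b)L} = 1/2 tr(X(d')M X(d'')L) + 1/2 (a, M        *)
(* replaced by phi(a), M^T), with d = {{a, b}} and constant M and L.          *)

Set Implicit Arguments.
Unset Strict Implicit.
Unset Printing Implicit Defensive.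

Import GRing.Theory.
Local Open Scope ring_scope.

(** The coordinate ring is generated by the entries of the matrices X(a). A derivation is thus
    determined by its values there ([derivation_ext]), and values compatible with the relations
    extend to one ([irep_derivation_derivation]). Uniqueness of the bracket follows
    ([biderivation_ext]). For existence, the averaged form must be antisymmetric
    ([generator_form_anti]) and respect the relations in one argument ([generator_form_data]). It
    respects X(phi(a)) = X(a)^T because flipping one argument exchanges the two halves of the
    average.

    The Jacobiator is a derivation in each argument ([jacobi_ext]), so generators suffice. There
    [bracket_nested] rewrites each nested bracket as a sum over flips, and [nested_bracket_cyclic]
    cancels the three sums.

    An entry of X(a) is a trace against a matrix unit. Acting by an orthogonal U conjugates the
    constant matrices in [bracket_trace]; since the inverse of U is U^T, this commutes with the
    transposition in the second half, whence [rmorph_bracket]. If M is skew and block-diagonal and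
    phi(mu) = -mu, the two signs in the second half cancel, so both halves give the same commutator
    ([bracket_moment_map]). *)

Lemma malgUZ (K : nzRingType) (T : choiceType) (c : K) (t : T) :
  << c *g t >> = c *: mbasis K t.
Proof.
apply/malgP => k; rewrite mcoeffZ mbasis.unlock !mcoeffU.
by rewrite mulr_natr.
Qed.

(** Monomials are handled by induction on the degree, splitting off one variable of the support. *)
Lemma cmonom_poly_ind (K : comNzRingType) (I : choiceType)
    (Q : {malg K[{cmonom I}]} -> Prop) :
  (forall c, Q c%:MP) -> (forall p q, Q p -> Q q -> Q (p + q)) ->
  (forall p q, Q p -> Q q -> Q (p * q)) ->
  (forall v, Q (mbasis K (ucm v))) -> forall p, Q p.
Proof.
move=> QC QD QM Qv p; rewrite (monalgE p).
elim/big_ind: _ => [|//|m _]; first by rewrite -malgC0E.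
rewrite malgUZ -mul_malgC.
apply: (QM) => //; move: m; suff Qm d : forall m : {cmonom I}, mdeg m = d -> Q (mbasis K m).
  by move=> m; apply: (Qm _ _ erefl).
elim: d => [|d IHd] m dm; first by rewrite (mdeg_eq0I dm) mbasis.unlock; apply: (QC 1).
have [i im] : exists i, i \in finsupp m.
  by apply/fset0Pn; apply: contra_eq_neq dm => m0; rewrite mdegE m0 big_seq_fset0.
have Em : m = mmul (ucm i) (divcm m (ucm i)).
  apply/eqP/cmP => j; rewrite cmM divcmE ucmE.
  by case: eqP => [<-|_]; rewrite ?subn0 // subnKC // lt0n cmE_neq0.
have -> : mbasis K m = mbasis K (ucm i) * mbasis K (divcm m (ucm i)).
  by rewrite {1}Em mbasis.unlock malgM_def fgmulUU mulr1.
apply: (QM) => //; apply: IHd; apply/eq_add_S.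
by rewrite -dm [in RHS]Em mdegM mdegU add1n.
Qed.

Lemma modpi_gen (K : pzRingType) (M : lmodType K) (G : M -> Prop) x :
  G x -> modpi G x = 0.
Proof.
move=> Gx; rewrite (esym (raddf0 (modpi G)) : 0 = modpi G 0) modpi.unlock.
by apply/eq_quotP; rewrite subr0; apply/asboolP/span_gen.
Qed.

(** * Tensor products *)

Lemma linear_zmod (K : pzRingType) (U V : lmodType K) (f : U -> V) :
  linear f -> zmod_morphism f.
Proof. by move=> fL x y; rewrite addrC -scaleN1r fL scaleN1r addrC. Qed.

Lemma linear_zero (K : pzRingType) (U V : lmodType K) (f : U -> V) :
  linear f -> f 0 = 0.
Proof. by move=> fL; rewrite -(subrr 0) (linear_zmod fL) subrr. Qed.

Lemma linear_opp (K : pzRingType) (U V : lmodType K) (f : U -> V) x :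
  linear f -> f (- x) = - f x.
Proof. by move=> fL; rewrite -sub0r (linear_zmod fL) (linear_zero fL) sub0r. Qed.

Lemma linear_big (K : pzRingType) (U V : lmodType K) (f : U -> V) (I : finType)
    (F : I -> U) : linear f -> f (\sum_i F i) = \sum_i f (F i).
Proof.
by move=> fL; apply: (big_morph f (zmod_morphD (linear_zmod fL)) (linear_zero fL)).
Qed.

Section TensorTheory.
Variables (K : nzRingType) (U V : lmodType K).

Lemma tensor_ind (Q : tensor U V -> Prop) :
  Q 0 -> (forall u v, Q (u ⊗ v)) -> (forall d d', Q d -> Q d' -> Q (d + d')) ->
  (forall c d, Q d -> Q (c *: d)) -> forall d, Q d.
Proof.
move=> Q0 Qp QD QZ d; rewrite -[d]modpi_repr; move: (repr d) => p.
rewrite (monalgE p) raddf_sum; elim/big_ind: _ => [//|//|[u v] _].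
by have := QZ p@_(u, v) _ (Qp u v); rewrite /tpure -linearZ malgUZ.
Qed.

Lemma tensor_linear_ext (W : lmodType K) (f g : tensor U V -> W) :
  linear f -> linear g -> (forall u v, f (u ⊗ v) = g (u ⊗ v)) -> f =1 g.
Proof.
move=> fL gL fg.
elim/tensor_ind=> [|//|d d' fd fd'|c d fd]; first by rewrite (linear_zero fL) (linear_zero gL).
  by rewrite -[d]scale1r fL gL fd fd'.
by rewrite -[_ *: _]addr0 fL gL fd (linear_zero fL) (linear_zero gL).
Qed.

Lemma tpure_linearl (v : V) : linear (fun u : U => u ⊗ v).
Proof.
move=> c u u'; apply/eqP; rewrite -subr_eq0 /tpure -linearP -raddfB; apply/eqP.
exact: modpi_gen (tensor_linl c u u' v).
Qed.

Lemma tpure_linearr (u : U) : linear (fun v : V => u ⊗ v).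
Proof.
move=> c v v'; apply/eqP; rewrite -subr_eq0 /tpure -linearP -raddfB; apply/eqP.
exact: modpi_gen (tensor_linr c u v v').
Qed.

End TensorTheory.

(** * Derivations of the coordinate ring *)

Section DualNumbers.
Variable B : comPzRingType.

(** The pair (x, y) stands for x + eps y with eps^2 = 0. Only the additive structure is taken from
    pairs, whose own product is componentwise. A ring morphism x |-> x + eps D(x) is the same as a
    derivation D. *)
Definition dual : Type := (B * B)%type.
HB.instance Definition _ := GRing.Zmodule.copy dual (B * B)%type.

Definition dual_mul (x y : dual) : dual := (x.1 * y.1, x.1 * y.2 + x.2 * y.1).

Fact dual_mulA : associative dual_mul.
Proof.
move=> x y z; congr pair; rewrite /= ?mulrA //.
by rewrite !mulrDr !mulrDl !mulrA addrA.
Qed.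
Fact dual_mulC : commutative dual_mul.
Proof.
move=> x y; congr pair; first exact: mulrC.
by rewrite addrC [x.2 * _]mulrC [x.1 * _]mulrC.
Qed.
Fact dual_mul1 : left_id ((1, 0) : dual) dual_mul.
Proof. by case=> a b; congr pair; rewrite /= mul1r // mul0r addr0. Qed.
Fact dual_mulDl : left_distributive dual_mul +%R.
Proof.
move=> x y z; congr pair; rewrite /= !mulrDl //.
by rewrite -!addrA; congr (_ + _); rewrite addrCA.
Qed.
HB.instance Definition _ := GRing.Zmodule_isComPzRing.Build dual
  dual_mulA dual_mulC dual_mul1 dual_mulDl.

Lemma dual_add1 (x y : dual) : (x + y).1 = x.1 + y.1. Proof. by []. Qed.
Lemma dual_add2 (x y : dual) : (x + y).2 = x.2 + y.2. Proof. by []. Qed.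
Lemma dual_mul_1 (x y : dual) : (dual_mul x y).1 = x.1 * y.1. Proof. by []. Qed.
Lemma dual_mul_2 (x y : dual) : (dual_mul x y).2 = x.1 * y.2 + x.2 * y.1.
Proof. by []. Qed.

Variables (K : comNzRingType) (iota : {rmorphism K -> B}).

Definition dual_const (c : K) : dual := (iota c, 0).
Fact dual_const_zmod : zmod_morphism dual_const.
Proof. by move=> c d; congr pair; rewrite /= ?rmorphB ?subr0. Qed.
Fact dual_const_monoid : monoid_morphism dual_const.
Proof.
split=> [|c d]; congr pair; rewrite /= ?rmorph1 ?rmorphM //.
by rewrite mulr0 mul0r addr0.
Qed.
HB.instance Definition _ := GRing.isZmodMorphism.Build K dual dual_const
  dual_const_zmod.
HB.instance Definition _ := GRing.isMonoidMorphism.Build K dual dual_const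
  dual_const_monoid.

Lemma dual_sum1 (I : Type) (r : seq I) (F : I -> dual) :
  (\sum_(i <- r) F i).1 = \sum_(i <- r) (F i).1.
Proof. by elim/big_rec2: _ => // i x y _ <-. Qed.
Lemma dual_sum2 (I : Type) (r : seq I) (F : I -> dual) :
  (\sum_(i <- r) F i).2 = \sum_(i <- r) (F i).2.
Proof. by elim/big_rec2: _ => // i x y _ <-. Qed.

End DualNumbers.

Section CoordinateRing.
Variables (K : fieldType) (A : algType K) (n : nat) (e : 'I_n -> A).
Variables (alpha : 'I_n -> nat) (phi : A -> A).
Local Notation N := (\sum_s alpha s)%N.
Local Notation ring := (irep_ring e alpha phi).
Local Notation X := (irep_X e alpha phi).
Implicit Types (D : ring -> ring) (f g h : ring).

Lemma irep_ind (Q : ring -> Prop) :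
  (forall c, Q (irep_const e alpha phi c)) -> (forall f g, Q f -> Q g -> Q (f + g)) ->
  (forall f g, Q f -> Q g -> Q (f * g)) ->
  (forall a i j, Q (X a i j)) -> forall f, Q f.
Proof.
move=> QC QD QM QX f; have [p <-] := irep_pi_surj f.
elim/cmonom_poly_ind: p => [//|p q Qp Qq|p q Qp Qq|[[a i] j]].
- by rewrite (rmorphD (irep_pi e phi)); apply: QD.
- by rewrite (rmorphM (irep_pi e phi)); apply: QM.
- have -> : mbasis K (ucm (a, i, j)) = rep_var a i j by [].
  by rewrite irep_pi_var.
Qed.

Lemma irep_scaleE (c : K) f : c *: f = irep_const e alpha phi c * f.
Proof. by []. Qed.

Definition derivation D := linear D /\ forall f g, D (f * g) = D f * g + f * D g.

Lemma derivation_add D : derivation D -> {morph D : f g / f + g}.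
Proof. by move=> dD; apply: zmod_morphD (linear_zmod (V := ring) dD.1). Qed.

Lemma derivation_const D c : derivation D -> D (irep_const e alpha phi c) = 0.
Proof.
case=> DL DM.
have D1 : D 1 = 0 by apply: (addIr (D 1)); rewrite -{3}[1]mulr1 DM mulr1 mul1r add0r.
have D0 : D 0 = 0 by apply: (linear_zero (V := ring) DL).
have -> : irep_const e alpha phi c = c *: (1 : ring) + 0.
  by rewrite addr0 irep_scaleE mulr1.
by rewrite DL D1 D0 scaler0 addr0.
Qed.

Lemma derivation_scale D c f : derivation D -> D (c *: f) = c *: D f.
Proof.
by move=> dD; rewrite irep_scaleE dD.2 derivation_const // mul0r add0r.
Qed.

Lemma derivation_ext D D' : derivation D -> derivation D' ->
  (forall a i j, D (X a i j) = D' (X a i j)) -> D =1 D'.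
Proof.
move=> dD dD' DX; elim/irep_ind=> [c|f g Df Dg|f g Df Dg|//].
- by rewrite !derivation_const.
- by rewrite !derivation_add // Df Dg.
- by rewrite dD.2 dD'.2 Df Dg.
Qed.

Lemma derivation0 : derivation (fun=> 0).
Proof. by split=> [c f g|f g]; rewrite ?scaler0 ?mul0r ?mulr0 addr0. Qed.

Lemma derivationD D D' : derivation D -> derivation D' ->
  derivation (fun f => D f + D' f).
Proof.
move=> [DL DM] [DL' DM']; split=> [c f g|f g].
  by rewrite DL DL' scalerDr addrACA.
by rewrite DM DM' mulrDr mulrDl addrACA.
Qed.

Lemma derivationMl h D : derivation D -> derivation (fun f => h * D f).
Proof.
move=> [DL DM]; split=> [c f g|f g].
  by rewrite DL mulrDr !irep_scaleE mulrCA.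
by rewrite DM mulrDr mulrA [h * (f * _)]mulrCA.
Qed.

Lemma derivationMr h D : derivation D -> derivation (fun f => D f * h).
Proof.
move=> dD; rewrite (_ : (fun f => _) = (fun f => h * D f)); first exact: derivationMl.
by apply: funext => f; rewrite mulrC.
Qed.

Lemma derivationZ c D : derivation D -> derivation (fun f => c *: D f).
Proof. exact: derivationMl. Qed.

Lemma derivationN D : derivation D -> derivation (fun f => - D f).
Proof.
move=> dD; rewrite (_ : (fun f => _) = (fun f => (-1) * D f)); first exact: derivationMl.
by apply: funext => f; rewrite mulN1r.
Qed.

Lemma derivation_sum (I : finType) (D : I -> ring -> ring) :
  (forall r, derivation (D r)) -> derivation (fun f => \sum_r D r f).
Proof.
move=> dD; elim: (index_enum I) => [|r s IHs].
  rewrite (_ : (fun f => _) = (fun=> 0)); first exact: derivation0.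
  by apply: funext => f; rewrite big_nil.
rewrite (_ : (fun f => _) = (fun f => D r f + \sum_(r <- s) D r f)).
  exact: derivationD.
by apply: funext => f; rewrite big_cons.
Qed.

(* The values v a i j of a derivation at the generators X(a)_ij are exactly   *)
(* the families compatible with the relations of the coordinate ring.         *)
Record derivation_data (v : A -> 'I_N -> 'I_N -> ring) : Prop := {
  dd_linear : forall c a b i j, v (c *: a + b) i j = c *: v a i j + v b i j;
  dd_mul : forall a b i j,
    v (a * b) i j = \sum_r (v a i r * X b r j + X a i r * v b r j);
  dd_idem : forall s i j, v (e s) i j = 0;
  dd_phi : forall a i j, v (phi a) i j = v a j i
}.

(** The eps-part of the morphism X(a)_ij |-> X(a)_ij + eps v a i j; meaningful when [v] satisfies
    [derivation_data]. *)
Definition irep_derivation (v : A -> 'I_N -> 'I_N -> ring) f : ring :=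
  (irep_lift (dual_const (irep_const e alpha phi))
     (fun a => \matrix_(i, j) ((X a i j, v a i j) : dual ring)) f).2.

Section Existence.
Variable v : A -> 'I_N -> 'I_N -> ring.
Hypothesis vdd : derivation_data v.

Let iota := dual_const (irep_const e alpha phi).
Let x a : 'M[dual ring]_N := \matrix_(i, j) ((X a i j, v a i j) : dual ring).

Let xE a i j : x a i j = (X a i j, v a i j) :> dual ring.
Proof. by rewrite mxE. Qed.

Let x_lin c a b : x (c *: a + b) = iota c *: x a + x b.
Proof.
apply/matrixP => i j; rewrite xE [RHS]mxE [X in _ = X + _]mxE !xE; congr pair => /=.
  exact: irep_X_linear.
by rewrite (dd_linear vdd) mul0r addr0.
Qed.

Let x_mul a b : x (a * b) = x a *m x b.
Proof.
apply/matrixP => i j; rewrite xE [RHS]mxE [RHS]surjective_pairing; congr pair => /=.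
  rewrite dual_sum1 irep_X_mul mxE; apply: eq_bigr => r _.
  by rewrite !xE.
rewrite dual_sum2 (dd_mul vdd); apply: eq_bigr => r _.
by rewrite !xE /= addrC.
Qed.

Let x_idem s : x (e s) = \matrix_(i, j) ((i == j) && (tagnat.sig1 i == s))%:R.
Proof.
apply/matrixP => i j; rewrite xE (dd_idem vdd) irep_X_idem [RHS]mxE mxE.
by case: (_ && _).
Qed.

Let x_phi a : x (phi a) = (x a)^T.
Proof.
by apply/matrixP => i j; rewrite xE [RHS]mxE xE (dd_phi vdd) irep_X_phi mxE.
Qed.

Lemma irep_derivation_X a i j : irep_derivation v (X a i j) = v a i j.
Proof. by rewrite /irep_derivation (irep_lift_X x_lin x_mul x_idem x_phi) xE. Qed.

Lemma irep_derivation_derivation : derivation (irep_derivation v).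
Proof.
pose F : ring -> dual ring := irep_lift iota x.
have FD f g : F (f + g) = F f + F g.
  exact: zmod_morphD (irep_lift_zmod x_lin x_mul x_idem x_phi) _ _.
have FM f g : F (f * g) = dual_mul (F f) (F g).
  exact: (irep_lift_monoid x_lin x_mul x_idem x_phi).2.
have FC c : F (irep_const e alpha phi c) = iota c.
  exact: (irep_lift_const x_lin x_mul x_idem x_phi).
have FX a i j : F (X a i j) = x a i j.
  exact: (irep_lift_X x_lin x_mul x_idem x_phi).
have E f : irep_derivation v f = (F f).2 by [].
(* From here only the listed properties of the lift are used, and it becomes a variable. *)
move: (irep_derivation v) F E FD FM FC FX => D F E FD FM FC FX.
(* Once the first component is the identity, multiplicativity of [F] reads as the Leibniz rule for
   the second. *)
have F1 f : (F f).1 = f.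
  elim/irep_ind: f => [c|f g Ff Fg|f g Ff Fg|a i j]; first by rewrite FC.
  - by rewrite FD dual_add1 Ff Fg.
  - by rewrite FM dual_mul_1 Ff Fg.
  - by rewrite FX xE.
split=> [c f g|f g]; rewrite !E.
  by rewrite irep_scaleE FD FM FC dual_add2 dual_mul_2 mul0r addr0.
by rewrite FM dual_mul_2 !F1 addrC.
Qed.

End Existence.

End CoordinateRing.

(** * Biderivations and their extension from generators *)

Section Bracket.
Variables (K : fieldType) (A : algType K) (n : nat) (e : 'I_n -> A).
Variables (alpha : 'I_n -> nat) (phi : A -> A).
Local Notation N := (\sum_s alpha s)%N.
Local Notation ring := (irep_ring e alpha phi).
Local Notation X := (irep_X e alpha phi).
Implicit Types (D : ring -> ring) (P : ring -> ring -> ring) (f g h : ring).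

Lemma derivation_opp D f : derivation D -> D (- f) = - D f.
Proof. by move=> dD; apply: (linear_opp (V := ring) f dD.1). Qed.

Lemma derivation_comm D D' : derivation D -> derivation D' ->
  derivation (fun f => D (D' f) - D' (D f)).
Proof.
move=> dD dD'; split=> [c f g|f g].
  by rewrite dD'.1 !dD.1 dD'.1 scalerBr opprD addrACA.
rewrite dD'.2 dD.2 (derivation_add dD) (derivation_add dD') !dD.2 !dD'.2.
(* The mixed terms D'f Dg and Df D'g occur in both compositions and cancel. *)
have cancel (u x y w v z : ring) : u + x + (y + w) - (v + y + (x + z)) = u - v + (w - z).
  rewrite [v + y + _]addrACA opprD addrACA; congr (_ + _).
    by rewrite opprD addrACA subrr addr0.
  by rewrite opprD addrACA subrr add0r.
by rewrite cancel mulrBl mulrBr.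
Qed.

Lemma biderivation_r P f : antisym_biderivation P -> derivation (P f).
Proof. by case=> PL _ PM; split. Qed.

Lemma biderivation_l P h : antisym_biderivation P -> derivation (P^~ h).
Proof.
move=> dP; rewrite (_ : P^~ h = fun f => - P h f).
  exact/derivationN/biderivation_r.
by apply: funext => f; rewrite (abd_antisym dP).
Qed.

Lemma biderivation_ext P P' : antisym_biderivation P -> antisym_biderivation P' ->
  (forall a b i j k l, P (X a i j) (X b k l) = P' (X a i j) (X b k l)) ->
  forall f h, P f h = P' f h.
Proof.
move=> dP dP' PX f; apply: derivation_ext; [exact: biderivation_r..|] => b k l.
move: f; apply: derivation_ext; [exact: (biderivation_l _ dP)|exact: (biderivation_l _ dP')|].
by move=> a i j; apply: PX.
Qed.

(** In its last argument the Jacobiator is [P f, P g] - P (P f g), a derivation; cyclic invariance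
    carries this over to the other two arguments. *)
Lemma jacobi_ext P : antisym_biderivation P ->
  let J f g h := P f (P g h) + P g (P h f) + P h (P f g) in
  (forall a b c i j k l u v, J (X a i j) (X b k l) (X c u v) = 0) ->
  forall f g h, J f g h = 0.
Proof.
move=> dP J JX.
have dJ f g : derivation (J f g).
  rewrite (_ : J f g = fun h => P f (P g h) - P g (P f h) + - P (P f g) h).
    by apply: derivationD; [apply: derivation_comm|apply: derivationN]; apply: biderivation_r.
  apply: funext => h; rewrite /J (abd_antisym dP h f) (abd_antisym dP h (P f g)).
  by rewrite (derivation_opp _ (biderivation_r g dP)).
have Jrot f g h : J f g h = J g h f by rewrite /J -addrA addrC.
have J0 f g : (forall c u v, J f g (X c u v) = 0) -> forall h, J f g h = 0.
  by move=> Jc; apply: (derivation_ext (dJ f g) (derivation0 _ _ _)).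
move=> f g; apply: (J0) => c u v; rewrite -Jrot.
move: g; apply: (J0) => b k l; rewrite -Jrot.
by move: f; apply: (J0) => a i j; exact: JX.
Qed.

Section Existence.
Variable F : A -> 'I_N -> 'I_N -> A -> 'I_N -> 'I_N -> ring.
Hypothesis F_data : forall a i j, derivation_data (F a i j).
Hypothesis F_anti : forall a i j b k l, F a i j b k l = - F b k l a i j.

(** Two successive lifts. For fixed (b, k, l), the inner one extends [F b k l] to a derivation, and
    the sign turns its value at X(a)_ij into [F a i j b k l]. The outer one extends the result in
    (b, k, l). *)
Definition generator_bracket f : ring -> ring :=
  irep_derivation (fun b k l => - irep_derivation (F b k l) f).

(** Each relation among the values is an identity between derivations of [f], so it can be checked
    at generators, where it is the same relation for [F]. *)
Let Gdd f : derivation_data (fun b k l => - irep_derivation (F b k l) f).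
Proof.
pose E b k l f := - irep_derivation (F b k l) f.
have dE b k l : derivation (E b k l).
  exact/derivationN/irep_derivation_derivation.
have EX b k l a i j : E b k l (X a i j) = F a i j b k l.
  by rewrite /E irep_derivation_X // F_anti opprK.
split=> [c a b i j|a b i j|s i j|a i j].
- apply: (derivation_ext (dE _ _ _) (derivationD (derivationZ c (dE a i j)) (dE b i j))).
  by move=> a' i' j'; rewrite !EX (dd_linear (F_data _ _ _)).
- pose D r f := E a i r f * X b r j + X a i r * E b r j f.
  have dD r : derivation (D r).
    by apply: derivationD; [apply: derivationMr|apply: derivationMl].
  apply: (derivation_ext (dE _ _ _) (derivation_sum dD)) => a' i' j'.
  rewrite !EX (dd_mul (F_data _ _ _)).
  by apply: eq_bigr => r _; rewrite /D !EX.
- apply: (derivation_ext (dE _ _ _) (derivation0 e alpha phi)) => a' i' j'.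
  by rewrite EX (dd_idem (F_data _ _ _)).
- apply: (derivation_ext (dE _ _ _) (dE a j i)) => a' i' j'.
  by rewrite !EX (dd_phi (F_data _ _ _)).
Qed.

Lemma generator_bracket_X a i j b k l :
  generator_bracket (X a i j) (X b k l) = F a i j b k l.
Proof.
by rewrite /generator_bracket irep_derivation_X // irep_derivation_X // F_anti opprK.
Qed.

(** The second argument is a derivation by construction. Identities in the first are compared as
    derivations of the second, hence at its generators, where the bracket is minus an inner lift. *)
Lemma generator_bracket_biderivation : antisym_biderivation generator_bracket.
Proof.
have dr f : derivation (generator_bracket f) by apply: irep_derivation_derivation.
have dl h : derivation (generator_bracket^~ h).
  have PX b k l f : generator_bracket f (X b k l) = - irep_derivation (F b k l) f.
    exact: irep_derivation_X.
  have dX b k l : derivation (fun f => - irep_derivation (F b k l) f).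
    exact/derivationN/irep_derivation_derivation.
  split=> [c f g|f g]; move: h.
  - apply: (derivation_ext (dr _) (derivationD (derivationZ c (dr f)) (dr g))).
    by move=> b k l /=; rewrite 3!PX; apply: (dX b k l).1.
  - apply: (derivation_ext (dr _)
      (derivationD (derivationMr g (dr f)) (derivationMl f (dr g)))).
    by move=> b k l /=; rewrite 3!PX; apply: (dX b k l).2.
split=> [f|f h|f]; [exact: (dr f).1| |exact: (dr f).2].
move: h; apply: (derivation_ext (dr f) (derivationN (dl f))) => b k l.
move: f; apply: (derivation_ext (dl _) (derivationN (dr _))) => a i j.
by rewrite !generator_bracket_X F_anti.
Qed.

End Existence.

End Bracket.

(** * The bracket on generators *)

Section DoubleBracketForm.
Variables (K : fieldType) (A : algType K) (n : nat) (e : 'I_n -> A).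
Variables (alpha : 'I_n -> nat) (phi : A -> A) (dbr : A -> A -> tensor A A).
Local Notation N := (\sum_s alpha s)%N.
Local Notation ring := (irep_ring e alpha phi).
Local Notation X := (irep_X e alpha phi).
Local Notation T := (tensor_coord e phi).
Implicit Types (i j k l u v : 'I_N) (a b c : A).

Lemma irep_scalerAr (c : K) (f g : ring) : f * (c *: g) = c *: (f * g).
Proof. by rewrite !irep_scaleE mulrCA. Qed.

Lemma tensor_coord_bilinear k j i l :
  bilinear_map (fun c d : A => X c k j * X d i l).
Proof.
split=> [d c a b|a c d d'].
  by rewrite irep_X_linear mulrDl -irep_scalerAl.
by rewrite irep_X_linear mulrDr irep_scalerAr.
Qed.

Lemma tensor_coord_linear k j i l : linear (T k j i l).
Proof. exact: tlift_linear (tensor_coord_bilinear k j i l). Qed.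

HB.instance Definition _ (k j i l : 'I_N) := GRing.isLinear.Build K (tensor A A) ring *:%R
  (T k j i l) (tensor_coord_linear k j i l).

Lemma tensor_coord_pure k j i l x y : T k j i l (x ⊗ y) = X x k j * X y i l.
Proof. exact: tlift_pure (tensor_coord_bilinear k j i l) _ _. Qed.

Lemma tensor_map_bilinear (U V : lmodType K) (f g : U -> V) :
  linear f -> linear g -> bilinear_map (fun x y => f x ⊗ g y).
Proof.
move=> fL gL; split=> [y c x x'|x c y y'].
  by rewrite fL tpure_linearl.
by rewrite gL tpure_linearr.
Qed.

Lemma touter_linear a b : linear (fun d : tensor A A => touter a d b).
Proof.
apply: tlift_linear; apply: (@tensor_map_bilinear _ _ ( *%R a) ( *%R^~ b)).
  by move=> c x y; rewrite mulrDr scalerAr.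
by move=> c x y; rewrite mulrDl scalerAl.
Qed.

Lemma touter_pure a b x y : touter a (x ⊗ y) b = (a * x) ⊗ (y * b) :> tensor A A.
Proof.
apply: tlift_pure; apply: (@tensor_map_bilinear _ _ ( *%R a) ( *%R^~ b)).
  by move=> c {}x {}y; rewrite mulrDr scalerAr.
by move=> c {}x {}y; rewrite mulrDl scalerAl.
Qed.

(** With [tensor_coord_touterl], this turns the Leibniz rule of the double bracket into [dd_mul]. *)
Lemma tensor_coord_touterr k j i l d c :
  T k j i l (touter 1 d c) = \sum_r T k j i r d * X c r l.
Proof.
move: d; apply: tensor_linear_ext => [s d d'|s d d'|x y].
- by rewrite touter_linear linearP.
- rewrite scaler_sumr -big_split; apply: eq_bigr => r _.
  by rewrite linearP mulrDl -irep_scalerAl.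
rewrite touter_pure mul1r tensor_coord_pure irep_X_mul [(_ *m _) _ _]mxE mulr_sumr.
by apply: eq_bigr => r _; rewrite tensor_coord_pure mulrA.
Qed.

Lemma tensor_coord_touterl k j i l b d :
  T k j i l (touter b d 1) = \sum_r X b k r * T r j i l d.
Proof.
move: d; apply: tensor_linear_ext => [s d d'|s d d'|x y].
- by rewrite touter_linear linearP.
- rewrite scaler_sumr -big_split; apply: eq_bigr => r _.
  by rewrite linearP mulrDr irep_scalerAr.
rewrite touter_pure mulr1 tensor_coord_pure irep_X_mul [(_ *m _) _ _]mxE mulr_suml.
by apply: eq_bigr => r _; rewrite tensor_coord_pure mulrA.
Qed.

Lemma tswap_bilinear : bilinear_map (fun x y : A => y ⊗ x).
Proof. by split=> [y|x] c u v; rewrite (tpure_linearl, tpure_linearr). Qed.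

Lemma tswap_pure (x y : A) : tswap (x ⊗ y) = y ⊗ x.
Proof. exact: tlift_pure tswap_bilinear _ _. Qed.

Lemma tswap_linear : linear (@tswap K A).
Proof. exact: tlift_linear tswap_bilinear. Qed.

Lemma tensor_coord_tswap k j i l d : T k j i l (tswap d) = T i l k j d.
Proof.
move: d; apply: tensor_linear_ext => [s d d'|s d d'|x y].
- by rewrite tswap_linear linearP.
- by rewrite linearP.
by rewrite tswap_pure !tensor_coord_pure mulrC.
Qed.

Hypothesis phi_linear : linear phi.

Lemma tensor_map_linear : linear (tensor_map phi).
Proof. exact: tlift_linear (tensor_map_bilinear phi_linear phi_linear). Qed.

Lemma tensor_map_pure x y : tensor_map phi (x ⊗ y) = phi x ⊗ phi y.
Proof. exact: tlift_pure (tensor_map_bilinear phi_linear phi_linear) _ _. Qed.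

Lemma tensor_coord_map k j i l d : T k j i l (tensor_map phi d) = T j k l i d.
Proof.
move: d; apply: tensor_linear_ext => [s d d'|s d d'|x y].
- by rewrite tensor_map_linear linearP.
- by rewrite linearP.
by rewrite tensor_map_pure !tensor_coord_pure !irep_X_phi ![_^T _ _]mxE.
Qed.

Hypotheses (dbr_db : double_bracket e dbr) (phi_invol : involutive phi).
Hypothesis phi_dbr :
  forall a b, tensor_map phi (dbr a b) = tswap (dbr (phi a) (phi b)).

Lemma dbr_phi_coord k j i l a b :
  T k j i l (dbr (phi a) (phi b)) = T l i j k (dbr a b).
Proof. by rewrite -(tensor_coord_map i l k j) phi_dbr tensor_coord_tswap. Qed.

Lemma dbr_antisym_coord k j i l a b : T k j i l (dbr a b) = - T i l k j (dbr b a).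
Proof.
rewrite (db_antisym dbr_db a b) -(tensor_coord_tswap k j i l (dbr b a)).
exact: (raddfN (T k j i l)).
Qed.

Lemma dbr_idem a s : dbr a (e s) = 0.
Proof.
(* Kronecker coefficients single out [e s] in the span of the idempotents. *)
rewrite -(db_A0r dbr_db (fun t => (t == s)%:R) a) (bigD1 s) //= eqxx scale1r.
by rewrite big1 ?addr0 // => t /negbTE ->; rewrite scale0r.
Qed.

Definition generator_form a i j b k l : ring :=
  2^-1 *: T k j i l (dbr a b) + 2^-1 *: T k i j l (dbr (phi a) b).
Local Notation F := generator_form.

(** Antisymmetry of the double bracket moves the flip in the second half onto the wrong generator;
    flipping both generators moves it back. *)
Lemma generator_form_anti a i j b k l : F a i j b k l = - F b k l a i j.
Proof.
rewrite /F dbr_antisym_coord (dbr_antisym_coord k i) -[X in dbr X (phi a)]phi_invol.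
by rewrite dbr_phi_coord !scalerN opprD.
Qed.

Lemma generator_form_data a i j : derivation_data (F a i j).
Proof.
rewrite /F; split=> [c b b' k l|b b' k l|s k l|b k l].
- rewrite !(db_linearr dbr_db) !tensor_coord_linear !scalerDr !scalerA.
  by rewrite ![2^-1 * c]mulrC -!scalerA addrACA.
- rewrite !(db_leibnizr dbr_db) !raddfD /= !tensor_coord_touterr !tensor_coord_touterl.
  rewrite !scaler_sumr addrACA -!big_split; apply: eq_bigr => r _ /=.
  by rewrite mulrDl mulrDr -!irep_scalerAl !irep_scalerAr.
- by rewrite !dbr_idem !raddf0 addr0.
(* Flipping [b] amounts to flipping [a], which exchanges the two halves. *)
- rewrite -{1}[a]phi_invol !dbr_phi_coord addrC; congr (_ + _).
Qed.

End DoubleBracketForm.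

(** * The Jacobi identity *)

Section Rotation.
Variables (K : comNzRingType) (U V W : lmodType K).

(** Three independent modules are allowed; [tau123] is the case where all are [A]. *)
Definition tensor_rot_pair (d : tensor U V) (z : W) : tensor (tensor W U) V :=
  tlift (fun x y => (z ⊗ x) ⊗ y) d.

Definition tensor_rot : tensor (tensor U V) W -> tensor (tensor W U) V :=
  tlift tensor_rot_pair.

Fact tensor_rot_pair_bilinear1 (z : W) :
  bilinear_map (fun (x : U) (y : V) => (z ⊗ x) ⊗ y).
Proof.
split=> [y c x x'|x c y y']; last by rewrite tpure_linearr.
by rewrite tpure_linearr tpure_linearl.
Qed.

Fact tensor_rot_pair_linear (z : W) : linear (tensor_rot_pair^~ z).
Proof. exact: tlift_linear (tensor_rot_pair_bilinear1 z). Qed.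

Fact tensor_rot_pair_pure x y z : tensor_rot_pair (x ⊗ y) z = (z ⊗ x) ⊗ y.
Proof. exact: tlift_pure (tensor_rot_pair_bilinear1 z) _ _. Qed.

Fact tensor_rot_pair_bilinear : bilinear_map tensor_rot_pair.
Proof.
split=> [z|d c z z']; first exact: tensor_rot_pair_linear.
move: d; apply: tensor_linear_ext => [s d d'|s d d'|x y].
- exact: tensor_rot_pair_linear.
- by rewrite !tensor_rot_pair_linear !scalerDr !scalerA [c * s]mulrC addrACA.
by rewrite !tensor_rot_pair_pure tpure_linearl tpure_linearl.
Qed.

Lemma tensor_rot_linear : linear tensor_rot.
Proof. exact: tlift_linear tensor_rot_pair_bilinear. Qed.

Lemma tensor_rot_pure x y z : tensor_rot ((x ⊗ y) ⊗ z) = (z ⊗ x) ⊗ y.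
Proof.
by rewrite /tensor_rot (tlift_pure tensor_rot_pair_bilinear) tensor_rot_pair_pure.
Qed.

Variables (f : U -> V) (fL : linear f).

Definition tensor_mapl : tensor U W -> tensor V W := tlift (fun x y => f x ⊗ y).

Fact tensor_mapl_bilinear : bilinear_map (fun (x : U) (y : W) => f x ⊗ y).
Proof.
split=> [y c x x'|x c y y']; last by rewrite tpure_linearr.
by rewrite fL tpure_linearl.
Qed.

Lemma tensor_mapl_linear : linear tensor_mapl.
Proof. exact: tlift_linear tensor_mapl_bilinear. Qed.

Lemma tensor_mapl_pure x y : tensor_mapl (x ⊗ y) = f x ⊗ y.
Proof. by rewrite /tensor_mapl (tlift_pure tensor_mapl_bilinear). Qed.

End Rotation.

Section Jacobi.
Variables (K : fieldType) (A : algType K) (n : nat) (e : 'I_n -> A).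
Variables (alpha : 'I_n -> nat) (phi : A -> A) (dbr : A -> A -> tensor A A).
Local Notation N := (\sum_s alpha s)%N.
Local Notation ring := (irep_ring e alpha phi).
Local Notation X := (irep_X e alpha phi).
Local Notation T := (tensor_coord e phi).
Implicit Types (i j k l u v : 'I_N) (a b c : A).

Definition tensor3_coord i j k l u v : tensor (tensor A A) A -> ring :=
  tlift (fun d z => T i j k l d * X z u v).
Local Notation T3 := tensor3_coord.

Lemma tensor3_coord_bilinear i j k l u v :
  bilinear_map (fun d (z : A) => T i j k l d * X z u v).
Proof.
split=> [z c d d'|d c z z'].
  by rewrite tensor_coord_linear mulrDl -irep_scalerAl.
by rewrite irep_X_linear mulrDr irep_scalerAr.
Qed.

Lemma tensor3_coord_linear i j k l u v : linear (T3 i j k l u v).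
Proof. exact: tlift_linear (tensor3_coord_bilinear i j k l u v). Qed.

HB.instance Definition _ (i j k l u v : 'I_N) :=
  GRing.isLinear.Build K (tensor (tensor A A) A) ring *:%R
  (T3 i j k l u v) (tensor3_coord_linear i j k l u v).

Lemma tensor3_coord_pure i j k l u v d z :
  T3 i j k l u v (d ⊗ z) = T i j k l d * X z u v.
Proof. exact: tlift_pure (tensor3_coord_bilinear i j k l u v) _ _. Qed.

Lemma tau123E : @tau123 K A = @tensor_rot K A A A.
Proof. by []. Qed.

Lemma tensor3_coord_tau i j k l u v t :
  T3 i j k l u v (tau123 t) = T3 k l u v i j t.
Proof.
move: t; apply: tensor_linear_ext => [s d d'|s d d'|d z].
- by rewrite tau123E tensor_rot_linear tensor3_coord_linear.
- exact: tensor3_coord_linear.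
move: d; apply: tensor_linear_ext => [s d d'|s d d'|x y].
- by rewrite tpure_linearl tau123E tensor_rot_linear tensor3_coord_linear.
- by rewrite tpure_linearl tensor3_coord_linear.
by rewrite tau123E tensor_rot_pure !tensor3_coord_pure !tensor_coord_pure -mulrA mulrC.
Qed.

Hypotheses (dbr_dp : double_poisson e dbr) (phi_linear : linear phi).
Hypothesis phi_invol : involutive phi.
Hypothesis phi_dbr :
  forall a b, tensor_map phi (dbr a b) = tswap (dbr (phi a) (phi b)).
Let dbr_db : double_bracket e dbr := dbr_dp.1.

Lemma dbrLE a : dbrL dbr a = tensor_mapl (dbr a).
Proof. by []. Qed.

Lemma dbrL_linear a : linear (dbrL dbr a).
Proof. by rewrite dbrLE; apply/tensor_mapl_linear/(db_linearr dbr_db). Qed.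

Lemma tensor3_coord_dbrL i j k l u v a x y :
  T3 i j k l u v (dbrL dbr a (x ⊗ y)) = T i j k l (dbr a x) * X y u v.
Proof.
by rewrite dbrLE (tensor_mapl_pure (db_linearr dbr_db a)) tensor3_coord_pure.
Qed.

(* A generator a_ij is encoded by the triple (a, i, j). *)
Local Notation gen := (A * 'I_N * 'I_N)%type.
Implicit Types x y z : gen.

(** The slots carry the index pairs (row of z, column of x), (row of x, column of y), (row of y,
    column of z), so rotating x, y, z permutes them as [tau123] does. *)
Definition nested_bracket x y z : ring :=
  T3 z.1.2 x.2 x.1.2 y.2 y.1.2 z.2 (dbrL dbr x.1.1 (dbr y.1.1 z.1.1)).
Local Notation G := nested_bracket.

Definition flip x : gen := (phi x.1.1, x.2, x.1.2).

Lemma flipK : involutive flip.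
Proof. by case=> [[a i] j]; rewrite /flip /= phi_invol. Qed.

Lemma nested_bracket_cyclic x y z : G x y z + G y z x + G z x y = 0.
Proof.
case: x y z => [[a i] j] [[b k] l] [[c u] v]; rewrite /G /=.
have := congr1 (T3 u j i l k v) (dbr_dp.2 a b c).
rewrite raddf0 /double_jacobiator !raddfD /=.
by rewrite tensor3_coord_tau (tensor3_coord_tau u) (tensor3_coord_tau i).
Qed.

(** Compatibility with [phi] is applied to the inner bracket, where antisymmetry gives the sign and
    exchanges y and z, and then to the outer one. *)
Lemma nested_bracket_flip x y z : G (flip x) (flip y) (flip z) = - G x z y.
Proof.
case: x y z => [[a i] j] [[b k] l] [[c u] v]; rewrite /G /=.
have -> : dbr (phi b) (phi c) = - tensor_map phi (dbr c b).
  by rewrite phi_dbr (db_antisym dbr_db).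
rewrite (linear_opp _ (dbrL_linear _)) (linear_opp _ (tensor3_coord_linear _ _ _ _ _ _)).
congr (- _); move: (dbr c b); apply: tensor_linear_ext => [s d d'|s d d'|x y].
- by rewrite tensor_map_linear // dbrL_linear tensor3_coord_linear.
- by rewrite dbrL_linear tensor3_coord_linear.
by rewrite tensor_map_pure // !tensor3_coord_dbrL dbr_phi_coord // irep_X_phi mxE.
Qed.
Variable P : ring -> ring -> ring.
Hypotheses (dP : antisym_biderivation P) (PE : bracket_formula dbr P).

(** The Leibniz rule on X(x)_pq X(y)_rs. As [dbrL] brackets with the left factor only, the term
    differentiating X(y)_rs needs [tswap]. *)
Lemma bracket_tensor_coord a i j p q r s (d : tensor A A) :
  P (X a i j) (T p q r s d) = 2^-1 *:
    (T3 p j i q r s (dbrL dbr a d) + T3 p i j q r s (dbrL dbr (phi a) d) +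
     (T3 r j i s p q (dbrL dbr a (tswap d)) +
      T3 r i j s p q (dbrL dbr (phi a) (tswap d)))).
Proof.
move: d; apply: tensor_linear_ext => [c d d'|c d d'|x y].
- by rewrite tensor_coord_linear (abd_linear dP).
- rewrite tswap_linear !dbrL_linear !tensor3_coord_linear scalerA [c * _]mulrC -scalerA.
  rewrite -scalerDr; congr (_ *: _); rewrite !scalerDr.
  rewrite (addrACA (c *: T3 p j i q r s _)) (addrACA (c *: T3 r j i s p q _)).
  exact: addrACA.
rewrite tensor_coord_pure (abd_leibniz dP) !PE tswap_pure !tensor3_coord_dbrL.
rewrite -!scalerDr irep_scalerAr -irep_scalerAl -scalerDr mulrDl mulrDr.
by rewrite [X x p q * T r _ _ _ _]mulrC [X x p q * T r i _ _ _]mulrC.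
Qed.

Local Notation Xg x := (X x.1.1 x.1.2 x.2).

Lemma bracket_generators x y : P (Xg x) (Xg y) =
  2^-1 *: \sum_(s : bool)
    T y.1.2 (iter s flip x).2 (iter s flip x).1.2 y.2
      (dbr (iter s flip x).1.1 y.1.1).
Proof. by rewrite PE big_bool /= scalerDr addrC. Qed.

Lemma bracket_nested x y z : P (Xg x) (P (Xg y) (Xg z)) = 4^-1 *:
  \sum_(s : bool) \sum_(t : bool) \sum_(w : bool)
    G (iter s flip x) (iter t flip y) (iter w flip z).
Proof.
have Gswap x' y' z' : T3 y'.1.2 x'.2 x'.1.2 z'.2 z'.1.2 y'.2
    (dbrL dbr x'.1.1 (tswap (dbr y'.1.1 z'.1.1))) = - G x' z' y'.
  rewrite -[tswap _]opprK -(db_antisym dbr_db) (linear_opp _ (dbrL_linear _)).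
  exact: linear_opp (tensor3_coord_linear _ _ _ _ _ _).
(* The swapped terms are -G x z' y' and -G (flip x) z' y'; flipping all arguments restores the order
   of y' and z'. Taking y' = y and y' = flip y then yields each of the eight flips once. *)
have PH y' z' : P (Xg x) (T z'.1.2 y'.2 y'.1.2 z'.2 (dbr y'.1.1 z'.1.1)) = 2^-1 *:
    (G x y' z' + G (flip x) y' z' +
     (G (flip x) (flip y') (flip z') + G x (flip y') (flip z'))).
  rewrite bracket_tensor_coord; congr (_ *: (_ + (_ + _))).
    by rewrite nested_bracket_flip -Gswap.
  by rewrite -[X in _ = G X _ _]flipK nested_bracket_flip -Gswap.
have dx := biderivation_r (Xg x) dP.
rewrite bracket_generators (derivation_scale _ _ dx) big_bool (derivation_add dx).
rewrite !PH -scalerDr scalerA -invfM -natrM !big_bool /= flipK.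
congr (_ *: _).
by rewrite [LHS](AC ((2*2)*(2*2)) ((7*2*(3*6))*(8*1*(4*5)))).
Qed.

Lemma bracket_jacobi f g h : P f (P g h) + P g (P h f) + P h (P f g) = 0.
Proof.
move: f g h; apply: jacobi_ext => // a b c i j k l u v.
rewrite -[X a i j]/(Xg (a, i, j)) -[X b k l]/(Xg (b, k, l)) -[X c u v]/(Xg (c, u, v)).
move: (a, i, j) (b, k, l) (c, u, v) => x y z; rewrite !bracket_nested -!scalerDr.
rewrite (_ : _ + _ = 0) ?scaler0 //.
(* The three sums are reordered to run over the flips of x, then y, then z, so that they cancel term
   by term. *)
under [X in _ + X + _]eq_bigr do rewrite exchange_big.
rewrite [X in _ + X + _]exchange_big [X in _ + _ + X]exchange_big.
under [X in _ + _ + X]eq_bigr do rewrite exchange_big.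
rewrite -!big_split big1 // => s _; rewrite -!big_split big1 // => t _.
by rewrite -!big_split big1 // => w _; apply: nested_bracket_cyclic.
Qed.

End Jacobi.

(** * The orthogonal action and the moment map *)

(** This makes every coordinate function a trace function with constant coefficients. *)
Lemma tr_mul_delta (B : pzRingType) p (Y : 'M[B]_p) i j :
  \tr (Y *m delta_mx j i) = Y i j.
Proof.
rewrite /mxtrace (bigD1 i) //= [X in _ + X]big1 ?addr0 => [|k /negbTE ki].
  rewrite mxE (bigD1 j) //= big1 ?addr0 => [|l /negbTE lj].
    by rewrite mxE !eqxx mulr1.
  by rewrite mxE lj mulr0.
by rewrite mxE big1 // => l _; rewrite mxE ki andbF mulr0.
Qed.

Lemma tr_conj (B : comPzRingType) p (U V M L : 'M[B]_p) :
  \tr (V *m M *m U *m L) = \tr (M *m (U *m L *m V)).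
Proof. by rewrite -!mulmxA mxtrace_mulC !mulmxA. Qed.

Lemma tr_conj2 (B : comPzRingType) p (U V M M' L L' : 'M[B]_p) :
  \tr (V *m M *m U *m L *m (V *m M' *m U) *m L') =
  \tr (M *m (U *m L *m V) *m M' *m (U *m L' *m V)).
Proof. by rewrite -!mulmxA mxtrace_mulC !mulmxA. Qed.

(** * Brackets of trace functions and equivariance *)

Section TraceForm.
Variables (K : fieldType) (A : algType K) (n : nat) (e : 'I_n -> A).
Variables (alpha : 'I_n -> nat) (phi : A -> A) (dbr : A -> A -> tensor A A).
Local Notation N := (\sum_s alpha s)%N.
Local Notation ring := (irep_ring e alpha phi).
Local Notation X := (irep_X e alpha phi).
Local Notation T := (tensor_coord e phi).
Local Notation const := (irep_const e alpha phi).
Local Notation cmx := (irep_mx e alpha phi).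
Implicit Types (i j k l : 'I_N) (a b c : A) (M L : 'M[ring]_N).

Lemma irep_X_zmod : zmod_morphism X.
Proof.
move=> a b; apply/matrixP => i j; have -> : a - b = (-1) *: b + a.
  by rewrite scaleN1r addrC.
rewrite irep_X_linear scaleN1r addrC [RHS]mxE; congr (_ + _).
by rewrite [RHS]mxE.
Qed.
HB.instance Definition _ :=
  GRing.isZmodMorphism.Build A 'M[ring]_N X irep_X_zmod.

(* On pure tensors this is c ⊗ d |-> tr (X(c) M X(d) L). *)
Definition trace_form M L (d : tensor A A) : ring :=
  \sum_k \sum_l (\sum_i \sum_j T k j i l d * M j i) * L l k.

Lemma trace_form_linear M L : linear (trace_form M L).
Proof.
move=> s d d'; rewrite /trace_form scaler_sumr -big_split; apply: eq_bigr => k _ /=.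
rewrite scaler_sumr -big_split; apply: eq_bigr => l _ /=.
rewrite irep_scalerAl -mulrDl; congr (_ * _).
rewrite scaler_sumr -big_split; apply: eq_bigr => i _ /=.
rewrite scaler_sumr -big_split; apply: eq_bigr => j _ /=.
by rewrite tensor_coord_linear mulrDl -irep_scalerAl.
Qed.

Lemma trace_form_pure M L x y :
  trace_form M L (x ⊗ y) = \tr (X x *m M *m X y *m L).
Proof.
rewrite /trace_form; apply: eq_bigr => k _; rewrite [RHS]mxE.
apply: eq_bigr => l _; congr (_ * _); rewrite [RHS]mxE.
apply: eq_bigr => i _; rewrite [in RHS]mxE mulr_suml.
by apply: eq_bigr => j _; rewrite tensor_coord_pure mulrAC.
Qed.

(* Scalar matrices enter as abstract matrices with this property: conversion  *)
(* between distinct constants of the coordinate ring diverges.                *)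
Definition constant_mx M : Prop := exists m : 'M[K]_N, M = cmx m.

Lemma constant_mx_entry M i j : constant_mx M -> exists c : K, M i j = const c.
Proof. by case=> m ->; exists (m i j); rewrite mxE. Qed.

Lemma constant_mxM M L : constant_mx M -> constant_mx L -> constant_mx (M *m L).
Proof. by case=> m -> [l ->]; exists (m *m l); apply/esym/map_mxM. Qed.

Lemma constant_mx_tr M : constant_mx M -> constant_mx M^T.
Proof. by case=> m ->; exists m^T; apply: map_trmx. Qed.

Lemma constant_delta_mx i j : constant_mx (delta_mx i j).
Proof. by exists (delta_mx i j); apply/esym/map_delta_mx. Qed.

Lemma derivation_tr (D : ring -> ring) Y M :
  derivation D -> constant_mx M -> D (\tr (Y *m M)) = \sum_i \sum_j D (Y i j) * M j i.
Proof.
move=> dD Mc; rewrite /mxtrace (linear_big (V := ring) _ dD.1).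
apply: eq_bigr => i _; rewrite mxE (linear_big (V := ring) _ dD.1).
apply: eq_bigr => j _; rewrite dD.2; have [c ->] := constant_mx_entry j i Mc.
by rewrite (derivation_const _ dD) mulr0 addr0.
Qed.

(** Derivations kill the entries of M and L, so this is the formula on generators summed against
    them. The exchange of i and j in its second half becomes M^T. *)
Lemma bracket_trace P M L a b :
  antisym_biderivation P -> bracket_formula dbr P -> constant_mx M -> constant_mx L ->
  P (\tr (X a *m M)) (\tr (X b *m L)) =
    2^-1 *: trace_form M L (dbr a b) + 2^-1 *: trace_form M^T L (dbr (phi a) b).
Proof.
move=> dP PE Mc Lc; rewrite (derivation_tr _ (biderivation_r _ dP)) // /trace_form.
rewrite !scaler_sumr -big_split; apply: eq_bigr => k _ /=.
rewrite !scaler_sumr -big_split; apply: eq_bigr => l _ /=.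
rewrite !irep_scalerAl -mulrDl; congr (_ * _).
rewrite (derivation_tr _ (biderivation_l _ dP)) //.
rewrite [in X in _ = _ + X]exchange_big !scaler_sumr -big_split; apply: eq_bigr => i _ /=.
rewrite !scaler_sumr -big_split; apply: eq_bigr => j _ /=.
by rewrite PE [_^T _ _]mxE mulrDl !irep_scalerAl.
Qed.

Section Equivariance.
Variables (F : {rmorphism ring -> ring}) (U : 'M[ring]_N).
Hypothesis F_const : forall c : K, F (const c) = const c.
Hypothesis F_X : forall a, map_mx F (X a) = U^T *m X a *m U.
Hypothesis U_const : constant_mx U.

Lemma irep_scale_rmorph (c : K) f : F (c *: f) = c *: F f.
Proof. by rewrite !irep_scaleE rmorphM F_const. Qed.

Lemma rmorph_constant_mx M : constant_mx M -> map_mx F M = M.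
Proof.
move=> Mc; apply/matrixP => i j; rewrite mxE.
by have [c ->] := constant_mx_entry i j Mc.
Qed.

Lemma rmorph_X a i j : F (X a i j) = \tr (X a *m (U *m delta_mx j i *m U^T)).
Proof.
have -> : F (X a i j) = map_mx F (X a) i j by rewrite [RHS]mxE.
by rewrite F_X -(tr_mul_delta _ i j) [LHS]tr_conj.
Qed.

Lemma rmorph_trace_form M L d : constant_mx M -> constant_mx L ->
  F (trace_form M L d) = trace_form (U *m M *m U^T) (U *m L *m U^T) d.
Proof.
move=> Mc Lc; move: d; apply: tensor_linear_ext => [s d d'|s d d'|x y].
- by rewrite trace_form_linear rmorphD irep_scale_rmorph.
- exact: trace_form_linear.
rewrite !trace_form_pure -trace_map_mx 3!map_mxM !F_X.
by rewrite (rmorph_constant_mx Mc) (rmorph_constant_mx Lc) [LHS]tr_conj2.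
Qed.

(** On generators, [F] replaces M by U M U^T in trace functions and likewise in trace forms; both
    halves agree because (U M U^T)^T = U M^T U^T. *)
Lemma rmorph_bracket P : antisym_biderivation P -> bracket_formula dbr P ->
  forall f h, F (P f h) = P (F f) (F h).
Proof.
move=> dP PE.
have PX a b i j k l : F (P (X a i j) (X b k l)) = P (F (X a i j)) (F (X b k l)).
  have c1 := constant_delta_mx j i; have c2 := constant_delta_mx l k.
  have c3 M : constant_mx M -> constant_mx (U *m M *m U^T).
    by move=> Mc; apply: constant_mxM (constant_mx_tr U_const); apply: constant_mxM.
  rewrite !rmorph_X (bracket_trace _ _ dP PE (c3 _ c1) (c3 _ c2)).
  rewrite -(tr_mul_delta (X a) i j) -(tr_mul_delta (X b) k l).
  rewrite (bracket_trace _ _ dP PE c1 c2) rmorphD !irep_scale_rmorph.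
  rewrite (rmorph_trace_form _ c1 c2) (rmorph_trace_form _ (constant_mx_tr c1) c2).
  by rewrite !trmx_mul trmxK mulmxA.
(* A relative [derivation_ext]: F after D and D' after F are both derivations along F. *)
have ext (D D' : ring -> ring) : derivation D -> derivation D' ->
    (forall a i j, F (D (X a i j)) = D' (F (X a i j))) -> forall f, F (D f) = D' (F f).
  move=> dD dD' DX; elim/irep_ind=> [c|f g Df Dg|f g Df Dg|//].
  - by rewrite F_const !derivation_const // rmorph0.
  - by rewrite (derivation_add dD) !rmorphD (derivation_add dD') Df Dg.
  - by rewrite dD.2 rmorphD !rmorphM dD'.2 Df Dg.
move=> f; apply: (ext); [exact: biderivation_r..|] => b k l.
apply: ((ext) (P^~ (X b k l)) (P^~ (F (X b k l)))); [exact: biderivation_l..|].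
by move=> a i j; apply: PX.
Qed.

End Equivariance.

End TraceForm.

Lemma scale_halves (K : fieldType) (V : lmodType K) (x : V) :
  2 != 0 :> K -> 2^-1 *: x + 2^-1 *: x = x.
Proof.
move=> K2; rewrite -scalerDl -[2^-1 + _]mulr2n -[2^-1 *+ 2]mulr_natr.
by rewrite mulVf // scale1r.
Qed.

Lemma orthogonal_mxdiag (K : comNzRingType) n (alpha : 'I_n -> nat)
    (g : forall s, 'M[K]_(alpha s)) :
  orthogonal_blocks g -> (\mxdiag_s g s)^T *m \mxdiag_s g s = 1%:M.
Proof. by move=> gO; rewrite tr_mxdiag mul_mxdiag -mxdiagZ; apply: eq_mxdiag. Qed.

Section Action.
Variables (K : fieldType) (A : algType K) (n : nat) (e : 'I_n -> A).
Variables (alpha : 'I_n -> nat) (phi : A -> A) (dbr : A -> A -> tensor A A).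
Local Notation N := (\sum_s alpha s)%N.
Local Notation ring := (irep_ring e alpha phi).
Local Notation X := (irep_X e alpha phi).
Local Notation cmx := (irep_mx e alpha phi).
Local Notation const := (irep_const e alpha phi).
Implicit Types g xi : forall s, 'M[K]_(alpha s).

Lemma irep_mx_orthogonal g : orthogonal_blocks g ->
  (cmx (\mxdiag_s g s))^T *m cmx (\mxdiag_s g s) = 1%:M.
Proof.
move=> gO; rewrite /irep_mx map_trmx -map_mxM orthogonal_mxdiag //.
exact: map_mx1.
Qed.

Lemma irep_act_rmorphism g : orthogonal_blocks g ->
  exists F : {rmorphism ring -> ring},
    [/\ irep_act g = F, forall c : K, F (const c) = const c &
        forall a, map_mx F (X a) =
          (cmx (\mxdiag_s g s))^T *m X a *m cmx (\mxdiag_s g s)].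
Proof.
move=> gO; have L : linear (irep_act g : ring -> ring) := irep_act_linear gO.
have M : monoid_morphism (irep_act g : ring -> ring) := irep_act_monoid e phi gO.
pose F : {rmorphism ring -> ring} := HB.pack (irep_act g : ring -> ring)
  (GRing.isZmodMorphism.Build ring ring _ (linear_zmod L))
  (GRing.isMonoidMorphism.Build ring ring _ M).
exists F; split=> // [c|a].
  rewrite -[const c]mulr1 -irep_scaleE -[_ *: _]addr0.
  by rewrite -[F _]/(irep_act g _) L -[irep_act g 0]/(F 0) raddf0 M.1.
apply/matrixP => i j; rewrite mxE -[F _]/(irep_act g _) irep_act_X //.
have GtG := orthogonal_mxdiag gO; have [_ Gu] := mulmx1_unit GtG.
have -> : invmx (\mxdiag_s g s) = (\mxdiag_s g s)^T.
  by rewrite -[RHS]mulmx1 -(mulmxV Gu) mulmxA GtG mul1mx.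
by rewrite /irep_mx map_trmx.
Qed.

Definition transpose_blocks g : forall s, 'M[K]_(alpha s) := fun s => (g s)^T.

Lemma transpose_blocks_orthogonal g :
  orthogonal_blocks g -> orthogonal_blocks (transpose_blocks g).
Proof. by move=> gO s; rewrite /transpose_blocks trmxK; apply: mulmx1C. Qed.

Lemma irep_act_cancel g h : orthogonal_blocks g -> orthogonal_blocks h ->
  \mxdiag_s h s = (\mxdiag_s g s)^T ->
  cancel (irep_act g : ring -> ring) (irep_act h : ring -> ring).
Proof.
move=> gO hO hg; have UtU := irep_mx_orthogonal gO.
have [F [-> FC FX]] := irep_act_rmorphism gO.
have [H [-> HC HX]] := irep_act_rmorphism hO.
have hU : cmx (\mxdiag_s h s) = (cmx (\mxdiag_s g s))^T.
  by rewrite hg; apply/esym/map_trmx.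
have Hconst M : constant_mx M -> map_mx H M = M by apply: rmorph_constant_mx.
have Uc : constant_mx (cmx (\mxdiag_s g s)) by exists (\mxdiag_s g s).
move: (cmx _) (cmx _) UtU FX HX hU Uc => U V UtU FX HX hU Uc.
elim/irep_ind=> [c|x y Hx Hy|x y Hx Hy|a i j].
- by rewrite FC HC.
- by rewrite !rmorphD Hx Hy.
- by rewrite !rmorphM Hx Hy.
have -> : F (X a i j) = map_mx F (X a) i j by rewrite [RHS]mxE.
have -> : H (map_mx F (X a) i j) = map_mx H (map_mx F (X a)) i j by rewrite [RHS]mxE.
rewrite FX !map_mxM (Hconst _ Uc) (Hconst _ (constant_mx_tr Uc)) HX hU trmxK.
by rewrite !mulmxA UtU mul1mx -mulmxA UtU mulmx1.
Qed.

Lemma irep_act_poisson_automorphism (P : ring -> ring -> ring) g :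
  antisym_biderivation P -> bracket_formula dbr P -> orthogonal_blocks g ->
  poisson_automorphism P (irep_act g).
Proof.
move=> dP PE gO; have tO := transpose_blocks_orthogonal gO.
split; [exact: irep_act_linear|exact: irep_act_monoid| |].
  exists (irep_act (transpose_blocks g)).
    by apply: irep_act_cancel => //; rewrite tr_mxdiag.
  apply: irep_act_cancel => //; rewrite tr_mxdiag; apply: eq_mxdiag => s.
  by rewrite /transpose_blocks trmxK.
have [F [-> FC FX]] := irep_act_rmorphism gO.
by apply: (rmorph_bracket FC FX _ dP PE); exists (\mxdiag_s g s).
Qed.

Hypothesis e_idem : idempotent_system e.

(** The relations prescribe X only on the idempotents; the unit is their sum. *)
Lemma irep_X1 : X 1 = 1%:M.
Proof.
rewrite -e_idem.2 raddf_sum; apply/matrixP => i j; rewrite summxE.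
transitivity (\sum_s ((i == j) && (tagnat.sig1 i == s))%:R : ring).
  by apply: eq_bigr => s _; rewrite /= irep_X_idem mxE.
rewrite [RHS]mxE [LHS](bigD1 (tagnat.sig1 i)) //= eqxx andbT [X in _ + X]big1 ?addr0 //.
by move=> s /negbTE si; rewrite [tagnat.sig1 i == s]eq_sym si andbF.
Qed.

Lemma tr_sum_idem (Y Z : 'M[ring]_N) :
  \sum_s \tr (Y *m X (e s) *m Z) = \tr (Y *m Z).
Proof.
rewrite -{2}[Y]mulmx1 -irep_X1 -e_idem.2 raddf_sum mulmx_sumr mulmx_suml.
exact/esym/raddf_sum.
Qed.

Lemma irep_X_idem_comm xi s :
  X (e s) *m cmx (\mxdiag_t xi t) = cmx (\mxdiag_t xi t) *m X (e s).
Proof. by rewrite irep_X_idem; apply: mul_idem_mxdiag. Qed.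

(** * The moment map *)

Section MomentMap.
Variable mu : A.
Hypotheses (dbr_db : double_bracket e dbr) (mu_mm : double_moment_map e dbr mu).

(** With E = X(e_s), the double bracket of mu_s contributes tr (X(b) E M E L) - tr (E M E X(b) L).
    Since E commutes with M, E M E = M E, and summing over s removes E. *)
Lemma moment_map_trace_form M L b : (forall s, X (e s) *m M = M *m X (e s)) ->
  trace_form M L (dbr mu b) = \tr ((X b *m M - M *m X b) *m L).
Proof.
move=> Me; have [mu_ [-> _ mu_b]] := mu_mm.
rewrite (linear_big _ (db_linearl dbr_db b)) (linear_big _ (trace_form_linear M L)).
have ee s : X (e s) *m X (e s) = X (e s) by rewrite -irep_X_mul e_idem.1 eqxx.
have ebr s : trace_form M L (dbr (mu_ s) b) =
    \tr (X b *m M *m X (e s) *m L) - \tr (M *m X (e s) *m (X b *m L)).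
  rewrite mu_b (linear_zmod (trace_form_linear M L)) !trace_form_pure !irep_X_mul.
  rewrite -(mulmxA (X b) (X (e s)) M) Me mulmxA -(mulmxA (X b *m M) (X (e s))) ee.
  by rewrite (mulmxA (M *m X (e s)) (X (e s))) -(mulmxA M (X (e s))) ee mulmxA.
rewrite (eq_bigr _ (fun s _ => ebr s)) sumrB !tr_sum_idem.
by rewrite mulmxBl (raddfB (@mxtrace _ _)) mulmxA.
Qed.

Hypotheses (K2 : 2 != 0 :> K) (phi_mu : mu + phi mu = 0).
Variable P : ring -> ring -> ring.
Hypotheses (dP : antisym_biderivation P) (PE : bracket_formula dbr P).

Lemma bracket_moment_map M b : constant_mx M -> M^T = - M ->
  (forall s, X (e s) *m M = M *m X (e s)) ->
  map_mx (P (\tr (X mu *m M))) (X b) = X b *m M - M *m X b.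
Proof.
move=> Mc MT Me; apply/matrixP => k l; rewrite [LHS]mxE -(tr_mul_delta (X b) k l).
rewrite (bracket_trace _ _ dP PE Mc (constant_delta_mx _ _ _ _)).
have -> : phi mu = - mu by apply/eqP; rewrite -addr_eq0 addrC phi_mu.
rewrite (linear_opp _ (db_linearl dbr_db b)) (linear_opp _ (trace_form_linear _ _)).
have MTe s : X (e s) *m M^T = M^T *m X (e s) by rewrite MT mulmxN mulNmx Me.
rewrite (moment_map_trace_form _ _ Me) (moment_map_trace_form _ _ MTe).
have -> : X b *m M^T - M^T *m X b = - (X b *m M - M *m X b).
  by rewrite MT mulmxN mulNmx opprK opprB addrC.
rewrite mulNmx (raddfN (@mxtrace _ _)) opprK /= !tr_mul_delta.
exact: scale_halves.
Qed.

Lemma moment_map_irep_X : moment_map P (X mu).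
Proof.
have skew xi : skew_blocks xi -> (cmx (\mxdiag_s xi s))^T = - cmx (\mxdiag_s xi s).
  move=> xiO; rewrite /irep_mx map_trmx tr_mxdiag -map_mxN; congr (map_mx _ _).
  by rewrite (eq_mxdiag xiO) mxdiagN.
split.
- rewrite -irep_X_phi; have -> : phi mu = - mu.
    by apply/eqP; rewrite -addr_eq0 addrC phi_mu.
  exact: raddfN.
- have [mu_ [-> mu_e _]] := mu_mm; move=> i j ij.
  (* As i and j lie in different blocks, one of them is outside block s, where X(e_s) has a zero row
     and column. *)
  rewrite raddf_sum summxE big1 //= => s _; have [x ->] := mu_e s.
  have E0 k l : tagnat.sig1 k != s \/ tagnat.sig1 l != s -> X (e s) k l = 0.
    rewrite irep_X_idem mxE; case: (eqVneq k l) => [->|_] //.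
    by move=> /= [] /negbTE ->.
  have [/eqP|] := eqVneq (tagnat.sig1 i) s => [js|js]; last first.
    by rewrite -mulrA irep_X_mul mxE; apply: big1 => k _; rewrite E0 ?mul0r //; left.
  have {}js : tagnat.sig1 j != s by rewrite -(eqP js) eq_sym.
  by rewrite irep_X_mul mxE; apply: big1 => k _; rewrite E0 ?mulr0 //; right.
- move=> g xi gO xiS; have [F [-> FC FX]] := irep_act_rmorphism gO.
  rewrite /trace_pairing -trace_map_mx map_mxM FX.
  have Xic : constant_mx (cmx (\mxdiag_s xi s)) by exists (\mxdiag_s xi s).
  rewrite (rmorph_constant_mx FC Xic) [LHS]tr_conj; congr (\tr (_ *m _)).
  rewrite /irep_mx map_trmx -!map_mxM tr_mxdiag !mul_mxdiag; congr (map_mx _ _).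
  apply: eq_mxdiag => s; congr (_ *m _).
  have [_ gu] := mulmx1_unit (gO s).
  by rewrite -[LHS]mulmx1 -(mulmxV gu) mulmxA gO mul1mx.
move=> xi xiS; have dr := biderivation_r (trace_pairing (X mu) xi) dP.
split; [exact: dr.1|exact: dr.2|] => a.
apply: bracket_moment_map; [by exists (\mxdiag_s xi s)|exact: skew|].
exact: irep_X_idem_comm.
Qed.

End MomentMap.

End Action.

Theorem theorem3p3 (R : realType) (A : algType R[i]) (n : nat) (e : 'I_n -> A)
    (dbr : A -> A -> tensor A A) (phi : A -> A)
    (A_fg : finitely_generated A)
    (e_idem : idempotent_system e)
    (dbr_poisson : double_poisson e dbr)
    (phi_linear : linear phi)
    (phi_antimul : forall a b, phi (a * b) = phi b * phi a)
    (phi_invol : involutive phi)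
    (phi_e : forall s, phi (e s) = e s)
    (phi_dbr : forall a b,
      tensor_map phi (dbr a b) = tswap (dbr (phi a) (phi b)))
    (alpha : 'I_n -> nat) :
  exists P : irep_ring e alpha phi -> irep_ring e alpha phi ->
             irep_ring e alpha phi,
    [/\ antisym_biderivation P /\ bracket_formula dbr P,
        forall P', antisym_biderivation P' -> bracket_formula dbr P' ->
          forall f h, P' f h = P f h,
        poisson_bracket P,
        forall g : (forall s, 'M[R[i]]_(alpha s)), orthogonal_blocks g ->
          poisson_automorphism P (irep_act g) &
        forall mu, double_moment_map e dbr mu -> mu + phi mu = 0 ->
          moment_map P (irep_X e alpha phi mu)].
Proof.
have dbr_db := dbr_poisson.1.
(* This lets the two equal halves of the moment map bracket add up to the whole. *)
have K2 : 2 != 0 :> R[i] by rewrite Num.Theory.pnatr_eq0.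
have Fdata := @generator_form_data _ _ _ e alpha phi dbr phi_linear dbr_db phi_invol phi_dbr.
have Fanti := @generator_form_anti _ _ _ e alpha phi dbr phi_linear dbr_db phi_invol phi_dbr.
pose P := generator_bracket (@generator_form _ _ _ e alpha phi dbr).
have dP : antisym_biderivation P := generator_bracket_biderivation Fdata Fanti.
have PE : bracket_formula dbr P.
  by move=> a b i j k l; apply: (generator_bracket_X Fdata Fanti).
exists P; split=> //.
- move=> P' dP' PE'; apply: biderivation_ext => // a b i j k l.
  by rewrite PE PE'.
- split=> //; exact: (bracket_jacobi dbr_poisson phi_linear phi_invol phi_dbr dP PE).
- by move=> g gO; apply: (irep_act_poisson_automorphism dP PE gO).
- move=> mu mu_mm phi_mu.
  exact: (moment_map_irep_X e_idem dbr_db mu_mm K2 phi_mu dP PE).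
Qed.
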